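(* Let $n\ge 3$ and $1\le r\le n$. As operators on symmetric polynomials in $x_1,\dots,x_n$, the third order $D_n^r(h^3)$ (the coefficient of $h^3$ in the $h$-expansion of the Macdonald operator $D_n^r$ with $q=\exp(h)$, $t=\exp(\beta h)$) is equal to $$\begin{aligned} &\frac16\binom{n-3}{r-2}\frac{n-2r}{r-1}H_3+\frac12\binom{n-3}{r-2}H_2H_1+\frac{n^2(3r-1)-7rn+6r}{12(n-2)}\binom{n-2}{r-1}\beta H_2\\ &+\frac16\binom{n-3}{r-3}H_1^3+\frac{\beta}{12}\binom{n-3}{r-1}\frac{(3r^2-3r+1)n^2+(-9r^2+6r)n+8r^2-6r}{(n-r)(n-r-1)}H_1^2\\ &+\frac{\beta^2 r}{24}\bigl((3r+1)n^2+(1-7r)n+2r\bigr)\binom{n-1}{r-1}H_1+\beta^3\binom{n}{r}\frac{r^2n(n-1)}{48}\bigl((r+1)n+1-3r\bigr). \end{aligned}$$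
   Context: Macdonald operators: for $1\le r\le n$, $$D_n^r=t^{r(r-1)/2}\sum_{I\subset\{1,\dots,n\},\,|I|=r}\ \prod_{i\in I,\,j\notin I}\frac{t x_i-x_j}{x_i-x_j}\ \prod_{i\in I}T_{q,x_i},\qquad T_{q,x_i}f(x_1,\dots,x_i,\dots,x_n)=f(x_1,\dots,qx_i,\dots,x_n),$$ acting on symmetric functions (polynomials) in $x_1,\dots,x_n$. Put $q=\exp(h)$, $t=\exp(\beta h)$ with $\beta$ a parameter, so $T_{q,x_i}=\exp(h\,x_i\partial_i)$, $\partial_i=\partial/\partial x_i$, and expand around $h=0$: $D_n^r=\sum_{k\ge0}D_n^r(h^k)\,h^k$. The operator $D_n^r(h^k)$ is called the $k$-th order of $D_n^r$. Dunkl operators: $d_i=x_i\partial_i+\beta\sum_{j\ne i}\frac{x_i}{x_i-x_j}(1-K_{i,j})$, where $K_{i,j}$ exchanges the variables $x_i$ and $x_j$ in a function, and $H_k=\sum_{i=1}^n d_i^k$, regarded as operators on symmetric polynomials in $x_1,\dots,x_n$. Conventions: $\binom{a}{b}=0$ if $b<0$ or $b>a$ (for $a\ge0$). For $r=1$ the expression $\binom{n-3}{r-2}\frac{n-2r}{r-1}$ is read as $\binom{n-3}{r-1}\frac{n-2r}{n-r-1}$. The expression $\binom{n-3}{r-1}\frac{1}{(n-r)(n-r-1)}$ is read as $\frac{(n-3)!}{(r-1)!\,(n-r)!}$ (this matters only for $r\in\{n-1,n\}$). *)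

(* Defs.v *)
From HB Require Import structures.
From mathcomp Require Import all_boot all_order all_fingroup all_algebra.
From mathcomp Require Import boolp.
From mathcomp Require Import mpoly.

Set Implicit Arguments.
Unset Strict Implicit.
Unset Printing Implicit Defensive.

Import GRing.Theory.

Local Open Scope ring_scope.

Notation "x %:F" := (tofrac x) : ring_scope.

(* Formal power series R[[h]]: [fps_coef u k] is the coefficient of h^k. *)
Record fps (R : Type) := Fps { fps_coef : nat -> R }.

HB.instance Definition _ (R : Type) := [isNew for @fps_coef R].
HB.instance Definition _ (R : choiceType) := [Choice of fps R by <:].

Lemma fpsP (R : Type) (u v : fps R) : fps_coef u =1 fps_coef v -> u = v.
Proof. by case: u v => [u] [v] /= /funext ->. Qed.

Section FpsZmod.
Variable R : zmodType.
Implicit Types u v w : fps R.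

Definition fps_zero : fps R := Fps (fun=> 0).
Definition fps_opp u : fps R := Fps (fun k => - fps_coef u k).
Definition fps_add u v : fps R := Fps (fun k => fps_coef u k + fps_coef v k).

Lemma fps_addA : associative fps_add.
Proof. by move=> u v w; apply: fpsP => k /=; rewrite addrA. Qed.

Lemma fps_addC : commutative fps_add.
Proof. by move=> u v; apply: fpsP => k /=; rewrite addrC. Qed.

Lemma fps_add0 : left_id fps_zero fps_add.
Proof. by move=> u; apply: fpsP => k /=; rewrite add0r. Qed.

Lemma fps_addN : left_inverse fps_zero fps_opp fps_add.
Proof. by move=> u; apply: fpsP => k /=; rewrite addNr. Qed.

HB.instance Definition _ :=
  GRing.isZmodule.Build (fps R) fps_addA fps_addC fps_add0 fps_addN.

End FpsZmod.

Section FpsRing.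
Variable R : comNzRingType.
Implicit Types u v w : fps R.

Definition fpsC (c : R) : fps R := Fps (fun k => if k == 0%N then c else 0).

Definition fps_mul u v : fps R :=
  Fps (fun k => \sum_(i < k.+1) fps_coef u i * fps_coef v (k - i)).

Let trunc m u : {poly R} := \poly_(i < m) fps_coef u i.

Let coef_trunc m u i : (i < m)%N -> (trunc m u)`_i = fps_coef u i.
Proof. by move=> lt_im; rewrite coef_poly lt_im. Qed.

Let coef_mul_trunc m u v i : (i < m)%N ->
  fps_coef (fps_mul u v) i = (trunc m u * trunc m v)`_i.
Proof.
move=> lt_im; rewrite coefM /=; apply: eq_bigr => j _.
have le_ji : (j <= i)%N by rewrite -ltnS.
by rewrite !coef_trunc // (leq_ltn_trans _ lt_im) // leq_subr.
Qed.

Lemma fps_mulA : associative fps_mul.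
Proof.
move=> u v w; apply: fpsP => k.
rewrite !(@coef_mul_trunc k.+1) //.
have -> : (trunc k.+1 u * trunc k.+1 (fps_mul v w))`_k
        = (trunc k.+1 u * (trunc k.+1 v * trunc k.+1 w))`_k.
  rewrite !coefM; apply: eq_bigr => j _; congr (_ * _).
  by rewrite coef_trunc ?ltnS ?leq_subr // (@coef_mul_trunc k.+1) ?ltnS ?leq_subr.
rewrite mulrA ![in RHS]coefM [LHS]coefM; apply: eq_bigr => j _; congr (_ * _).
by rewrite coef_trunc // (@coef_mul_trunc k.+1).
Qed.

Lemma fps_mulC : commutative fps_mul.
Proof.
by move=> u v; apply: fpsP => k; rewrite !(@coef_mul_trunc k.+1) // mulrC.
Qed.

Lemma fps_mul1 : left_id (fpsC 1) fps_mul.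
Proof.
move=> u; apply: fpsP => k /=.
by rewrite big_ord_recl /= mul1r subn0 big1 ?addr0 // => i _; rewrite mul0r.
Qed.

Lemma fps_mulDl : left_distributive fps_mul +%R.
Proof.
move=> u v w; apply: fpsP => k /=; rewrite -big_split /=.
by apply: eq_bigr => i _; rewrite mulrDl.
Qed.

Lemma fps_oner_neq0 : fpsC 1 != 0.
Proof.
by apply/eqP => /(congr1 (fun u => fps_coef u 0)) /= /eqP; rewrite oner_eq0.
Qed.

HB.instance Definition _ := GRing.Zmodule_isComNzRing.Build (fps R)
  fps_mulA fps_mulC fps_mul1 fps_mulDl fps_oner_neq0.

Definition fps_unit : {pred fps R} := fun u => `[< exists v, v * u = 1 >].

Let fps_inv_ex u (uU : fps_unit u) : exists v, v * u == 1.
Proof. by have /asboolP[v uv1] := uU; exists v; apply/eqP. Qed.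

Definition fps_inv u : fps R :=
  if pselect (fps_unit u) is left uU then xchoose (fps_inv_ex uU) else u.

Lemma fps_mulVx : {in fps_unit, left_inverse 1 fps_inv *%R}.
Proof.
move=> u uU; rewrite /fps_inv; case: pselect => // uU'.
exact/eqP/(xchooseP (fps_inv_ex uU')).
Qed.

Lemma fps_unitPl u v : v * u = 1 -> fps_unit u.
Proof. by move=> vu1; apply/asboolP; exists v. Qed.

Lemma fps_invr_out : {in [predC fps_unit], fps_inv =1 id}.
Proof. by move=> u uNU; rewrite /fps_inv; case: pselect uNU => // uU /negP. Qed.

HB.instance Definition _ := GRing.ComNzRing_hasMulInverse.Build (fps R)
  fps_mulVx fps_unitPl fps_invr_out.

End FpsRing.

(* exp(c h) in F[[h]]; meaningful when F has characteristic 0. *)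
Definition fps_exp (F : fieldType) (c : F) : fps F :=
  Fps (fun k => c ^+ k / k`!%:R).

Section Macdonald.
Variables (n : nat) (S : comUnitRingType).

Definition qshift (q : S) (i : 'I_n) (g : ('I_n -> S) -> S) : ('I_n -> S) -> S :=
  fun x => g (fun k => if k == i then q * x k else x k).

(* The shifts T_{q,x_i} commute, so the order of composition is irrelevant. *)
Definition qshifts (q : S) (I : {set 'I_n}) (g : ('I_n -> S) -> S) :
    ('I_n -> S) -> S :=
  foldr (qshift q) g (enum I).

Definition macdonald (q t : S) (r : nat) (g : ('I_n -> S) -> S) :
    ('I_n -> S) -> S :=
  fun x => t ^+ (r * (r - 1))./2 *
    \sum_(I : {set 'I_n} | #|I| == r)
      (\prod_(i in I) \prod_(j in ~: I) ((t * x i - x j) / (x i - x j)))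
      * qshifts q I g x.

End Macdonald.

Section Expansion.
Variables (K : fieldType) (n : nat).

(* The expansion of the Macdonald operator in h takes place in K(x)[[h]], *)
(* K(x) = K(x_1, ..., x_n): scalars, variables and x_i - x_j are constant *)
(* series, and the x_i - x_j (i != j) are invertible.                     *)
Local Notation series := (fps {fraction {mpoly K[n]}}).

Definition series_of (p : {mpoly K[n]}) : series := fpsC p%:F.

Definition poly_fun (f : {mpoly K[n]}) (y : 'I_n -> series) : series :=
  mmap (fun c : K => series_of c%:MP) y f.

(* The k-th order D_n^r(h^k) of D_n^r at q = exp(h), t = exp(beta h). *)
Definition macdonald_order (beta : K) (r k : nat) (f : {mpoly K[n]}) :
    {fraction {mpoly K[n]}} :=
  fps_coef (macdonald (fps_exp 1 : series) (fps_exp beta%:MP%:F : series) r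
              (poly_fun f) (fun i => series_of 'X_i)) k.

End Expansion.

Section Dunkl.
Variables (K : fieldType) (n : nat).
Implicit Types (f : {mpoly K[n]}) (i j : 'I_n).

Definition exchange i j f : {mpoly K[n]} := msym (tperm i j) f.

Lemma divdiff_ex i j f :
  exists g : {mpoly K[n]}, ('X_i - 'X_j) * g == f - exchange i j f.
Proof.
pose P f := exists g : {mpoly K[n]}, ('X_i - 'X_j) * g = f - exchange i j f.
suff [g Pg] : P f by exists g; apply/eqP.
have PC c : P c%:MP.
  by exists 0; rewrite mulr0 /exchange /msym mmapC subrr.
have PD p1 p2 : P p1 -> P p2 -> P (p1 + p2).
  move=> [g1 P1] [g2 P2]; exists (g1 + g2).
  by rewrite mulrDr P1 P2 /exchange raddfD opprD addrACA.
have PM p1 p2 : P p1 -> P p2 -> P (p1 * p2).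
  move=> [g1 P1] [g2 P2]; exists (g1 * p2 + exchange i j p1 * g2).
  rewrite mulrDr mulrA P1 mulrCA P2 /exchange rmorphM /=.
  by rewrite mulrBl mulrBr addrA subrK.
have PX k : P 'X_k.
  rewrite /P /exchange /msym mmapX mmap1U.
  have [->|ki] := eqVneq k i; first by exists 1; rewrite tpermL mulr1.
  have [->|kj] := eqVneq k j; first by exists (-1); rewrite tpermR mulrN1 opprB.
  by exists 0; rewrite tpermD 1?eq_sym // mulr0 subrr.
elim/mpolyind: f => [|c m p _ _ IHp]; first exact: (PC 0).
apply: PD => //; rewrite -mul_mpolyC; apply: (PM) => //.
rewrite mpolyXE_id; apply: (big_ind P); [exact: (PC 1) | exact: (PM) | move=> k _].
elim: (m k) => [|d IHd]; first exact: (PC 1).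
by rewrite exprS; apply: (PM).
Qed.

(* (1 - K_{i,j}) f / (x_i - x_j), which is a polynomial; it is unique when *)
(* i != j.                                                                  *)
Definition divdiff i j f : {mpoly K[n]} := xchoose (divdiff_ex i j f).

Lemma divdiffP i j f : ('X_i - 'X_j) * divdiff i j f = f - exchange i j f.
Proof. exact/eqP/(xchooseP (divdiff_ex i j f)). Qed.

Definition dunkl (beta : K) i f : {mpoly K[n]} :=
  'X_i * f^`M(i) + beta *: \sum_(j | j != i) 'X_i * divdiff i j f.

Definition dunklH (beta : K) (k : nat) f : {mpoly K[n]} :=
  \sum_(i < n) iter k (dunkl beta i) f.

End Dunkl.

Definition binomz (a : nat) (b : int) : nat :=
  if b is Posz k then 'C(a, k) else 0%N.

(* binom(n-3, r-2) (n-2r)/(r-1), extended to r = 1 by the equal expression *)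
(* binom(n-3, r-1) (n-2r)/(n-r-1).                                         *)
Definition coefH3 (K : fieldType) (n r : nat) : K :=
  if r == 1%N
  then (binomz (n - 3) (r%:Z - 1))%:R * ((n%:R - 2 * r%:R) / (n%:R - r%:R - 1))
  else (binomz (n - 3) (r%:Z - 2))%:R * ((n%:R - 2 * r%:R) / (r%:R - 1)).

(* binom(n-3, r-1) / ((n-r)(n-r-1)) for 1 <= r <= n, with its value         *)
(* (n-3)!/((r-1)!(n-r)!) also for r = n-1 and r = n.                        *)
Definition coefH11 (K : fieldType) (n r : nat) : K :=
  (n - 3)`!%:R / ((r - 1)`!%:R * (n - r)`!%:R).

(* Main.v *)
Require Import Defs.
From HB Require Import structures.
From mathcomp Require Import all_boot all_order all_fingroup all_algebra.
From mathcomp Require Import boolp.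
From mathcomp Require Import mpoly.
From mathcomp Require Import ring zify.

Set Implicit Arguments.
Unset Strict Implicit.
Unset Printing Implicit Defensive.

Import GRing.Theory.

Local Open Scope ring_scope.

(* Write th_i = x_i d/dx_i and let Delta be the Vandermonde product.  The      *)
(* prefactor of T_{q,I} in Delta * D_n^r is T_{t,I} Delta, so with t = q^beta  *)
(*   Delta * D_n^r(h^k) f                                                      *)
(*     = sum_{|I| = r} sum_{a+b=k} beta^a/(a! b!) (th_I^a Delta) (th_I^b f),   *)
(* where th_I = sum_{i in I} th_i.  For k = 3, counting the sets I containing  *)
(* given i, j, k rewrites this in terms of the full sums over i, j, k.  They   *)
(* are evaluated with sum_i th_i^k Delta = (sum_{m<n} m^k) Delta, with         *)
(* th_i Delta / Delta = v_i := sum_j u_ij, where u_ij = x_i/(x_i - x_j), and   *)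
(* with th_i^2 Delta / Delta = a_i := v_i^2 + sum_j u_ij u_ji.  On symmetric f *)
(* one finds, using u_ij + u_ji = 1 and                                        *)
(* u_ij u_ik + u_ji u_jk + u_ki u_kj = 1, that                                 *)
(*   H_2 f = sum th_i^2 f + 2 beta sum v_i th_i f - beta (n-1) H_1 f,          *)
(*   H_3 f = sum th_i^3 f + 3 beta sum v_i th_i^2 f + 3 beta^2 sum a_i th_i f  *)
(*           - beta/2 H_1^2 f - beta (n - 3/2) (sum th_i^2 f                   *)
(*           + 2 beta sum v_i th_i f) - beta^2 (n-1) H_1 f,                    *)
(* so that the non-polynomial terms can be eliminated.                         *)

(** * Sums of x_i / (x_i - x_j) *)

(** Multiplying by Delta removes the rational prefactors of the Macdonald operator ([vdm_shift]),
    and a shift by exp(c h) in the variables of I is exp(c h th_I) ([poly_fun_shifted]). So Delta *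
    D_n^r(h^3) f distributes three copies of th_I over Delta and f ([macdonald_order_vdm]). Summing
    over I only needs the number of r-sets containing one, two or three given indices
    ([sum_subsets3]), and sum_i th_i^k acts on Delta as a scalar ([sum_iter_theta_vdm]).

    What remains are the sums T_k of th_i^k f, and sums V in which th_i Delta or th_i^2 Delta meets
    a derivative of f. The same sums occur in H_2 and H_3 ([tofrac_dunklH2], [tofrac_dunklH3]), in
    the same proportions: after division by Delta, T_3 comes with 3 beta V_2 + 3 beta^2 V_3, and T_2
    with 2 beta V_1. Hence solving for T_2 and T_3 removes every V ([third_order_identity]). As all
    binomial coefficients are [coefH11] times rational functions of n and r, a rational identity in
    n, r and beta is left. *)

Lemma sum_deltal (R : pzRingType) (I : finType) (j : I) (F : I -> R) :
  \sum_i (i == j)%:R * F i = F j.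
Proof.
rewrite (bigD1 j) //= eqxx mul1r big1 ?addr0 // => i /negbTE->.
by rewrite mul0r.
Qed.

Lemma sum_deltar (R : pzRingType) (I : finType) (j : I) (F : I -> R) :
  \sum_i (j == i)%:R * F i = F j.
Proof. by under eq_bigr do rewrite eq_sym; rewrite sum_deltal. Qed.

Section Kernel.
Variables (F : comPzRingType) (n : nat) (u : 'I_n -> 'I_n -> F).

Definition ksum i := \sum_j u i j.
Local Notation v := ksum.

(* If u i j = x_i / (x_i - x_j), th_i = x_i d/dx_i and Delta is the          *)
(* Vandermonde product, then th_i Delta = ksum i * Delta and                 *)
(* th_i^2 Delta = ksum2 i * Delta.                                           *)
Definition ksum2 i := v i ^+ 2 + \sum_j u i j * u j i.

Local Notation N := (n%:R : F).

Hypothesis ukernii : forall i, u i i = 0.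
Hypothesis ukernC : forall i j, u j i = 1 - (i == j)%:R - u i j.
Hypothesis ukern_triple : forall i j k, i != j -> j != k -> i != k ->
  u i j * u i k + u j i * u j k + u k j * u k i = 1.

Lemma sum_ukernl j : \sum_i u i j = N - 1 - v j.
Proof.
under eq_bigr do rewrite (ukernC j).
rewrite !sumrB big_const_ord iter_addr_0.
under [X in _ - X - _]eq_bigr do rewrite -[(j == _)%:R]mulr1.
by rewrite sum_deltar.
Qed.

(** Kronecker corrections extend the three-term identity to coinciding indices, so that it can be
    summed over all i and k. *)
Let ukern_triple_delta i j k :
  u i j * u i k + u j i * u j k + u k j * u k i =
  (1 - (i == j)%:R) * (1 - (k == j)%:R) - (i == k)%:R * (1 - (i == j)%:R)
  + (k == j)%:R * (u i j - u i j * u j i)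
  + (i == j)%:R * (u k j - u k j * u j k)
  + (i == k)%:R * (u j i - u i j * u j i).
Proof.
have [->|ij] := eqVneq i j.
  have [->|kj] := eqVneq j k; rewrite ?eqxx ?ukernii /=; first by ring.
  by rewrite (ukernC j k) (negbTE kj) /=; ring.
have [->|kj] := eqVneq k j.
  by rewrite ukernii (ukernC i j) (negbTE ij) /=; ring.
have [->|ik] := eqVneq i k.
  by rewrite ukernii (ukernC k j) (negbTE kj) /=; ring.
rewrite ukern_triple // 1?eq_sym //=; ring.
Qed.

(** Sum the three-term identity over i and k with j fixed: the first and third products each give
    sum_i v_i u_ij, the middle one gives v_j^2. *)
Lemma sum_ksum_ukern j :
  2 * \sum_i v i * u i j = 2 * v j ^+ 2 - 3 * ksum2 j - v j + N * (N - 1).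
Proof.
have E : \sum_i \sum_k (u i j * u i k + u j i * u j k + u k j * u k i) =
   2 * (\sum_i v i * u i j) + v j ^+ 2.
  under eq_bigr do rewrite !big_split /= -!mulr_sumr.
  rewrite !big_split /= -mulr_suml [X in _ + X]exchange_big /=.
  under [X in _ + X]eq_bigr do rewrite -mulr_sumr.
  under [in RHS]eq_bigr do rewrite mulrC.
  by rewrite -/(v j); ring.
have -> (w : F) : 2 * w = 2 * w + v j ^+ 2 - v j ^+ 2 by rewrite addrK.
rewrite -E; under eq_bigr do under eq_bigr do rewrite ukern_triple_delta.
have S1 : \sum_k (1 - (k == j)%:R) = N - 1.
  rewrite sumrB big_const_ord iter_addr_0.
  by under [X in _ - X]eq_bigr do rewrite -[(_ == j)%:R]mulr1; rewrite sum_deltal.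
have D1 : \sum_i \sum_k (1 - (i == j)%:R) * (1 - (k == j)%:R) = (N - 1) * (N - 1).
  by under eq_bigr do rewrite -mulr_sumr S1; rewrite -mulr_suml S1.
have D2 (h : 'I_n -> F) : \sum_i \sum_k (i == k)%:R * h i = \sum_i h i.
  by apply: eq_bigr => i _; rewrite sum_deltar.
have D3 (h : 'I_n -> F) : \sum_i \sum_k (k == j)%:R * h i = \sum_i h i.
  by apply: eq_bigr => i _; rewrite sum_deltal.
have D4 (h : 'I_n -> F) : \sum_i \sum_k (i == j)%:R * h k = \sum_i h i.
  by rewrite exchange_big; apply: eq_bigr => i _; rewrite sum_deltal.
under eq_bigr do rewrite !big_split /= sumrN.
rewrite !big_split /= sumrN D1 !D2 D3 D4 S1 !sumrB sum_ukernl.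
rewrite /ksum2 -/(v j).
under [X in _ = _ - 3 * (_ + X) - _ + _]eq_bigr do rewrite mulrC.
ring.
Qed.

Let sum_ukern_subl (h : 'I_n -> F) i :
  \sum_j u i j * (h i - h j) = v i * h i - \sum_j u i j * h j.
Proof. by under eq_bigr do rewrite mulrBr; rewrite sumrB -mulr_suml. Qed.

(** Exchanging the two sums brings in the column sums [sum_ukernl]. For h_i = th_i f this is the
    beta part of H_2 f; for h_i = d_i^2 f it is the outermost exchange part of H_3 f. *)
Lemma sum_ukern_sub (h : 'I_n -> F) :
  \sum_i \sum_j u i j * (h i - h j)
  = 2 * (\sum_i v i * h i) - (N - 1) * \sum_i h i.
Proof.
under eq_bigr do rewrite sum_ukern_subl.
rewrite sumrB [X in _ - X]exchange_big /=.
under [X in _ - X]eq_bigr do rewrite -mulr_suml sum_ukernl mulrBl.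
by rewrite sumrB -mulr_sumr; ring.
Qed.

(** Read f1, f2, f3 as th_i f, th_i th_j f, th_i^3 f; then g i is d_i^2 f and the left side is 2 H_3
    f, for f symmetric. The products u_ij u_ji come from th_i u_ij = u_ij u_ji. The factor 2 allows
    symmetrisation in i and j without division. *)
Lemma dunkl3_kernel (b : F) (f1 : 'I_n -> F) (f2 : 'I_n -> 'I_n -> F)
    (f3 : 'I_n -> F) (g := fun i => f2 i i + b * \sum_j u i j * (f1 i - f1 j)) :
  (forall i j, f2 i j = f2 j i) ->
  2 * (\sum_i (f3 i + b * \sum_j (u i j * (f2 i i - f2 i j)
                                   + u i j * u j i * (f1 i - f1 j))
                + b * \sum_j u i j * (g i - g j)))
  = 2 * (\sum_i f3 i) + 6 * b * (\sum_i v i * f2 i i)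
    + 6 * b ^+ 2 * (\sum_i ksum2 i * f1 i)
    - b * (\sum_i \sum_j f2 i j)
    - b * (2 * N - 3) * (\sum_i f2 i i + 2 * b * \sum_i v i * f1 i)
    - 2 * b ^+ 2 * (N - 1) * (\sum_i f1 i).
Proof.
move=> f2C.
(* The weight u_ij u_ji is symmetric in i and j, the difference antisymmetric. *)
have anti : \sum_i \sum_j u i j * u j i * (f1 i - f1 j) = 0.
  under eq_bigr do under eq_bigr do rewrite mulrBr.
  under eq_bigr do rewrite sumrB.
  rewrite sumrB [X in _ - X]exchange_big /=.
  under [X in _ - X]eq_bigr do under eq_bigr do rewrite [u _ _ * _]mulrC.
  by rewrite subrr.
have mixed : 2 * (\sum_i \sum_j u i j * (f2 i i - f2 i j)) =
    2 * (\sum_i v i * f2 i i) - \sum_i \sum_j f2 i j + \sum_i f2 i i.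
  under eq_bigr do under eq_bigr do rewrite mulrBr.
  under eq_bigr do rewrite sumrB -mulr_suml -/(v _).
  rewrite sumrB mulrBr -addrA; congr (_ + _).
  (* Since f2 is symmetric, doubling the sum replaces u_ij by u_ij + u_ji, which is 1 off the
     diagonal and 0 on it. *)
  rewrite mulr_natl mulr2n {1}exchange_big /= -big_split /=.
  under eq_bigr => i _.
    rewrite -big_split /=.
    under eq_bigr => j _.
      have -> : u j i * f2 j i + u i j * f2 i j
              = f2 i j - (i == j)%:R * f2 i j.
        by rewrite f2C ukernC; ring.
      over.
    rewrite sumrB sum_deltar.
    over.
  by rewrite sumrB opprB addrC.
have vg : 2 * (\sum_i v i * g i) = 2 * (\sum_i v i * f2 i i)
    + b * (\sum_i (3 * ksum2 i + v i - N * (N - 1)) * f1 i).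
  rewrite /g; under eq_bigr do rewrite mulrDr.
  rewrite big_split mulrDr /=; congr (_ + _).
  under eq_bigr do rewrite mulrCA.
  rewrite -mulr_sumr mulrCA; congr (_ * _).
  (* Collecting the coefficient of each f1 j produces the sum evaluated by [sum_ksum_ukern]. *)
  have -> : \sum_i v i * (\sum_j u i j * (f1 i - f1 j)) =
      \sum_j (v j ^+ 2 - \sum_i v i * u i j) * f1 j.
    under [RHS]eq_bigr do rewrite mulrBl mulr_suml.
    rewrite sumrB [X in _ = _ - X]exchange_big /= -sumrB; apply: eq_bigr => i _.
    rewrite sum_ukern_subl mulrBr mulrA -expr2 mulr_sumr.
    by congr (_ - _); apply: eq_bigr => j _; rewrite mulrA.
  rewrite mulr_sumr; apply: eq_bigr => j _; rewrite mulrA mulrBr.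
  by rewrite sum_ksum_ukern; congr (_ * _); ring.
have sg : \sum_i g i = \sum_i f2 i i
    + b * (2 * (\sum_i v i * f1 i) - (N - 1) * \sum_i f1 i).
  by rewrite /g big_split /= -mulr_sumr sum_ukern_sub.
rewrite !big_split /= -!mulr_sumr sum_ukern_sub sg.
have -> : \sum_i \sum_j (u i j * (f2 i i - f2 i j) + u i j * u j i * (f1 i - f1 j))
    = \sum_i \sum_j u i j * (f2 i i - f2 i j).
  by under eq_bigr do rewrite big_split /=; rewrite big_split /= anti addr0.
have e (X Y Z : F) : 2 * (X + b * Y + b * Z) = 2 * X + b * (2 * Y) + 2 * (b * Z).
  by ring.
rewrite e mixed vg.
have -> : \sum_i (3 * ksum2 i + v i - N * (N - 1)) * f1 i = 3 * (\sum_i ksum2 i * f1 i)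
    + \sum_i v i * f1 i - N * (N - 1) * \sum_i f1 i.
  rewrite !mulr_sumr -big_split -sumrB /=; apply: eq_bigr => i _; ring.
ring.
Qed.
End Kernel.

Section UKern.
Variables (F : fieldType) (n : nat) (x : 'I_n -> F).
Hypothesis x_inj : injective x.

(* As 1/0 = 0, the diagonal terms vanish and sums over j != i may run over *)
(* all j.                                                                  *)
Definition ukern i j := x i / (x i - x j).
Local Notation u := ukern.

Lemma ukernii i : u i i = 0.
Proof. by rewrite /u subrr invr0 mulr0. Qed.

Let subx_neq0 i j : i != j -> x i - x j != 0.
Proof. by move=> ij; rewrite subr_eq0 (inj_eq x_inj). Qed.

Lemma ukernC i j : u j i = 1 - (i == j)%:R - u i j.
Proof.
have [->|ij] := eqVneq i j; first by rewrite ukernii !subrr.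
by rewrite /u /=; field; rewrite ?subx_neq0 // 1?eq_sym.
Qed.

Lemma ukern_triple i j k : i != j -> j != k -> i != k ->
  u i j * u i k + u j i * u j k + u k j * u k i = 1.
Proof.
move=> ij jk ik; rewrite /u; field.
by rewrite ?subx_neq0 // 1?eq_sym.
Qed.

End UKern.

(** * Power series and Euler operators *)

Section Fps.
Variable R : comNzRingType.
Implicit Types (u v : fps R) (c : R).

Lemma fps_coefM u v k :
  fps_coef (u * v) k = \sum_(i < k.+1) fps_coef u i * fps_coef v (k - i).
Proof. by []. Qed.

Lemma fps_coefD u v k : fps_coef (u + v) k = fps_coef u k + fps_coef v k.
Proof. by []. Qed.

Lemma fps_coef_sum (I : Type) (s : seq I) (P : pred I) (G : I -> fps R) k :
  fps_coef (\sum_(i <- s | P i) G i) k = \sum_(i <- s | P i) fps_coef (G i) k.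
Proof. by apply: (big_morph (fun u => fps_coef u k)). Qed.

Lemma fps_coefCM c u k : fps_coef (fpsC c * u) k = c * fps_coef u k.
Proof.
rewrite fps_coefM big_ord_recl /= subn0 big1 ?addr0 // => i _.
by rewrite mul0r.
Qed.

Lemma fpsC_is_zmod_morphism : zmod_morphism (@fpsC R).
Proof. by move=> c d; apply: fpsP => k /=; case: eqP; rewrite ?subr0. Qed.

Lemma fpsC_is_monoid_morphism : monoid_morphism (@fpsC R).
Proof.
split=> // c d; apply: fpsP => k; rewrite fps_coefCM /=.
by case: eqP; rewrite ?mulr0.
Qed.

HB.instance Definition _ := GRing.isZmodMorphism.Build R (fps R) (@fpsC R)
  fpsC_is_zmod_morphism.
HB.instance Definition _ := GRing.isMonoidMorphism.Build R (fps R) (@fpsC R)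
  fpsC_is_monoid_morphism.

End Fps.

Section FpsExp.
Variable F : fieldType.
Hypothesis charF : [pchar F] =i pred0.

Lemma natf_neq0_pchar0 k : (0 < k)%N -> k%:R != 0 :> F.
Proof. by rewrite (pcharf0P F).1 // -lt0n. Qed.

Lemma fps_expD (a b : F) : fps_exp (a + b) = fps_exp a * fps_exp b.
Proof.
apply: fpsP => k; rewrite fps_coefM /= exprDn mulr_suml.
rewrite (reindex_inj rev_ord_inj); apply: eq_bigr => i _ /=.
have le_ik : (i <= k)%N by rewrite -ltnS.
rewrite subSS subKn // bin_sub //.
have /(congr1 (fun m => m%:R : F)) := bin_fact le_ik; rewrite !natrM => E.
rewrite -[_ *+ 'C(k, i)]mulr_natr.
have k0 := natf_neq0_pchar0 (fact_gt0 k).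
have i0 := natf_neq0_pchar0 (fact_gt0 i).
have d0 := natf_neq0_pchar0 (fact_gt0 (k - i)).
apply: (mulIf k0); rewrite mulfVK // -[in RHS]E; field.
by rewrite i0 d0.
Qed.

Lemma fps_exp0 : fps_exp (0 : F) = 1.
Proof.
by apply: fpsP => -[|k] /=; rewrite ?expr0 ?fact0 ?divr1 // expr0n mul0r.
Qed.

Lemma fps_expX (c : F) m : fps_exp c ^+ m = fps_exp (c *+ m).
Proof.
elim: m => [|m IH]; first by rewrite expr0 mulr0n fps_exp0.
by rewrite exprS IH mulrS fps_expD.
Qed.

End FpsExp.

Section MpolyInd.
Variables (n : nat) (R : comNzRingType) (P : {mpoly R[n]} -> Prop).

Lemma mpoly_ring_ind :
  (forall c, P c%:MP) -> (forall i, P 'X_i) ->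
  (forall p q, P p -> P q -> P (p + q)) ->
  (forall p q, P p -> P q -> P (p * q)) -> forall p, P p.
Proof.
move=> PC PX PD PM; elim/mpolyind => [|c m p _ _ IH]; first exact: (PC 0).
apply: (PD) => //; rewrite -mul_mpolyC; apply: (PM) => //.
rewrite mpolyXE_id; apply: (big_ind P); [exact: (PC 1) | exact: PM |].
move=> i _; elim: (m i) => [|d IHd]; first exact: (PC 1).
by rewrite exprS; apply: PM.
Qed.

End MpolyInd.

HB.lock Definition theta (n : nat) (R : comNzRingType) (i : 'I_n)
  (p : {mpoly R[n]}) : {mpoly R[n]} := 'X_i * p^`M(i).

Section Euler.
Variables (n : nat) (R : comNzRingType).
Local Notation theta := (@theta n R).
Implicit Types (p q : {mpoly R[n]}) (i j : 'I_n) (c : R).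

Fact theta_is_linear i : linear (theta i).
Proof.
by move=> c p q; rewrite theta.unlock linearP mulrDr scalerAr.
Qed.

HB.instance Definition _ i := GRing.isLinear.Build R {mpoly R[n]} {mpoly R[n]}
  *:%R (theta i) (theta_is_linear i).

Lemma thetaD i p q : theta i (p + q) = theta i p + theta i q.
Proof. exact: linearD. Qed.

Lemma thetaZ i c p : theta i (c *: p) = c *: theta i p.
Proof. exact: linearZ. Qed.

Lemma thetaM i p q : theta i (p * q) = theta i p * q + p * theta i q.
Proof. by rewrite theta.unlock mderivM; ring. Qed.

Lemma thetaC i c : theta i c%:MP = 0.
Proof. by rewrite theta.unlock mderivC mulr0. Qed.

Lemma thetaXm i m : theta i 'X_[m] = (m i)%:R *: 'X_[m].
Proof.
rewrite theta.unlock mderivX -scalerAr -mpolyXD.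
have [->|mi] := posnP (m i); first by rewrite !scale0r.
by rewrite addmC submK // lep1mP -lt0n.
Qed.

Lemma thetaX i j : theta i 'X_j = (i == j)%:R *: 'X_j.
Proof. by rewrite thetaXm mnm1E eq_sym. Qed.

Lemma theta_comm i j p : theta i (theta j p) = theta j (theta i p).
Proof.
elim/mpolyind: p => [|c m p _ _ IH]; first by rewrite !linear0.
rewrite !linearD /= IH; congr (_ + _).
rewrite !linearZ /= !thetaXm !linearZ /= !thetaXm !scalerA; congr (_ *: _); ring.
Qed.

Definition thetas (I : {set 'I_n}) p := \sum_(i in I) theta i p.

Fact thetas_is_linear I : linear (thetas I).
Proof.
move=> c p q; rewrite /thetas scaler_sumr -big_split /=.
by apply: eq_bigr => i _; rewrite linearP.
Qed.

HB.instance Definition _ I := GRing.isLinear.Build R {mpoly R[n]} {mpoly R[n]}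
  *:%R (thetas I) (thetas_is_linear I).

Lemma iter_thetasXm I k m :
  iter k (thetas I) 'X_[m] = (\sum_(i in I) m i)%:R ^+ k *: 'X_[m].
Proof.
elim: k => [|k IH]; first by rewrite expr0 scale1r.
rewrite iterS IH linearZ /= exprSr -scalerA; congr (_ *: _).
rewrite natr_sum scaler_suml; apply: eq_bigr => i _; exact: thetaXm.
Qed.

Lemma msymXi s i : msym s 'X_i = 'X_(s i) :> {mpoly R[n]}.
Proof. by rewrite /msym mmapX mmap1U. Qed.

Lemma msym_theta s i p : msym s (theta i p) = theta (s i) (msym s p).
Proof.
elim/mpoly_ring_ind: p => [c|j|p q Ep Eq|p q Ep Eq].
- by rewrite thetaC msym0 /msym mmapC thetaC.
- by rewrite thetaX msymZ msymXi thetaX (inj_eq perm_inj).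
- by rewrite thetaD !msymD thetaD Ep Eq.
- by rewrite thetaM msymD !msymM Ep Eq thetaM.
Qed.

End Euler.

(** * The q-shifts as exponentials *)

Lemma qshiftsE n (S : comUnitRingType) (q : S) (I : {set 'I_n}) g x :
  qshifts q I g x = g (fun k => if k \in I then q * x k else x k).
Proof.
rewrite /qshifts; under [in RHS]eq_fun do rewrite -mem_enum.
elim: (enum I) (enum_uniq I) x => [|i s IH] //= /andP[is_s us] x.
rewrite /qshift IH //; congr g; apply/funext => k.
rewrite in_cons; have [->|//] := eqVneq k i.
by rewrite (negbTE is_s).
Qed.

Lemma if_exprM (S : comPzRingType) (b : bool) (e x : S) m :
  (if b then e * x else x) ^+ m = (if b then e ^+ m else 1) * x ^+ m.
Proof. by case: b; rewrite ?mul1r ?exprMn. Qed.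

Section PolyFun.
Variables (K : fieldType) (n : nat).
Hypothesis charK : [pchar K] =i pred0.
Local Notation MP := {mpoly K[n]}.
Local Notation L := {fraction MP}.
Local Notation series := (fps L).
Implicit Types (p q : MP) (I : {set 'I_n}).

Definition scalar_series (c : K) : series := series_of c%:MP.

Fact scalar_series_is_zmod_morphism : zmod_morphism scalar_series.
Proof. by move=> c d; rewrite /scalar_series /series_of !rmorphB. Qed.
Fact scalar_series_is_monoid_morphism : monoid_morphism scalar_series.
Proof.
by split=> [|c d]; rewrite /scalar_series /series_of ?rmorph1 ?rmorphM.
Qed.

HB.instance Definition _ := GRing.isZmodMorphism.Build K series
  scalar_series scalar_series_is_zmod_morphism.
HB.instance Definition _ := GRing.isMonoidMorphism.Build K series
  scalar_series scalar_series_is_monoid_morphism.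

Lemma poly_funE (y : 'I_n -> series) p : poly_fun p y = mmap scalar_series y p.
Proof. by []. Qed.

Lemma tofracZ (c : K) p : (c *: p)%:F = c%:MP%:F * p%:F.
Proof. by rewrite -mul_mpolyC rmorphM. Qed.

Lemma tofracC_inv (c : K) : (c^-1)%:MP%:F = (c%:MP%:F)^-1 :> L.
Proof.
have [->|c0] := eqVneq c 0; first by rewrite !(invr0, mpolyC0, tofrac0).
apply: (mulIf (_ : c%:MP%:F != 0)); first by rewrite tofrac_eq0 mpolyC_eq0.
rewrite mulVf ?tofrac_eq0 ?mpolyC_eq0 // -tofracM -mpolyCM mulVf //.
Qed.

Lemma natr_frac m : (m%:R : L) = (m%:R%:MP : MP)%:F.
Proof. by rewrite !rmorph_nat. Qed.

Lemma pchar_frac : [pchar L] =i pred0.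
Proof.
apply/pcharf0P => m.
by rewrite natr_frac tofrac_eq0 mpolyC_eq0 (pcharf0P K).1.
Qed.

Definition shifted (c : K) I : 'I_n -> series :=
  fun k => if k \in I then fps_exp c%:MP%:F * series_of 'X_k else series_of 'X_k.

(** A monomial of degree e in the variables of I is multiplied by exp(c e h), and it is an
    eigenvector of th_I with eigenvalue e; so the substitution is exp(c h th_I). *)
Lemma poly_fun_shifted (c : K) I p m :
  fps_coef (poly_fun p (shifted c I)) m
  = ((c ^+ m / m`!%:R) *: iter m (thetas I) p)%:F.
Proof.
have iterP k : linear (iter k (@thetas n K I)).
  by elim: k => // k IH a p1 p2; rewrite !iterS IH linearP.
elim/mpolyind: p => [|a mm p _ _ IH].
  have -> : iter m (thetas I) 0 = 0 :> MP by elim: m => //= m ->; rewrite linear0.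
  by rewrite poly_funE mmap0 scaler0 rmorph0.
rewrite poly_funE mmapD mmapZ fps_coefD -poly_funE IH iterP scalerDr tofracD.
congr (_ + _).
rewrite poly_funE mmapX -[_ a]/(fpsC a%:MP%:F) fps_coefCM.
rewrite iter_thetasXm !tofracZ [RHS]mulrCA; congr (_ * _).
have -> : mmap1 (shifted c I) mm
   = fps_exp (c *+ (\sum_(i in I) mm i))%:MP%:F * series_of 'X_[mm].
  rewrite /mmap1; transitivity (\prod_(i < n)
      ((if i \in I then fps_exp c%:MP%:F ^+ mm i else 1)
       * series_of 'X_i ^+ mm i)).
    by apply: eq_bigr => i _; rewrite -if_exprM.
  rewrite big_split -big_mkcond /=; congr (_ * _); last first.
    rewrite [in RHS]mpolyXE_id /series_of !rmorph_prod.
    by apply: eq_bigr => i _; rewrite !rmorphXn.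
  rewrite prodrXr fps_expX; last exact: pchar_frac.
  by rewrite mpolyCMn tofracMn.
rewrite mulrC fps_coefCM mulrC /= mulrA; congr (_ * _).
rewrite natr_frac -tofracC_inv -tofracXn -!tofracM -rmorphXn -!rmorphM /=.
by rewrite -(mulr_natr c) exprMn mulrAC.
Qed.

End PolyFun.

(** * The Macdonald operator through the Vandermonde product *)

Definition vdm (n : nat) (S : pzRingType) (x : 'I_n -> S) : S :=
  \prod_(i < n) \prod_(j < n | (i < j)%N) (x j - x i).

Lemma card_pairs_lt n (I : {set 'I_n}) :
  (\sum_(i in I) \sum_(j in I | i < j) 1 = (#|I| * (#|I| - 1))./2)%N.
Proof.
set c := LHS.
have c' : (\sum_(i in I) \sum_(j in I | j < i) 1 = c)%N.
  rewrite /c (exchange_big_dep (mem I)) /=; last by move=> i j _ /andP[].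
  by apply: eq_bigr => i iI; apply: eq_bigl => j; rewrite iI.
suff E : (#|I| * #|I| = c + c + #|I|)%N.
  have -> : (#|I| * (#|I| - 1) = c.*2)%N by rewrite mulnBr muln1 E addnK addnn.
  by rewrite doubleK.
have -> : (#|I| * #|I| = \sum_(i in I) \sum_(j in I) 1)%N.
  by rewrite sum1_card sum_nat_const.
rewrite -{1}c' /c -[X in (_ + X)%N]sum1_card -!big_split /=.
apply: eq_bigr => i iI.
rewrite (bigID (fun j : 'I_n => j < i)%N) /= -addnA; congr (_ + _)%N.
rewrite (bigD1 i) ?iI ?ltnn //= addnC; congr (_ + _)%N.
apply: eq_bigl => j; case: (j \in I) => //=.
by rewrite -leqNgt [RHS]ltn_neqAle andbC eq_sym.
Qed.

Section VdmShift.
Variables (n : nat) (S : comUnitRingType) (x : 'I_n -> S) (t : S).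
Hypothesis x_unit : forall i j, i != j -> x i - x j \is a GRing.unit.
Variable I : {set 'I_n}.

(** Compare pair by pair. A pair inside I contributes a factor t, which accounts for the power of t;
    a pair split by I contributes one fraction, whose denominator cancels; a pair outside I is
    unchanged. *)
Lemma vdm_shift :
  t ^+ (#|I| * (#|I| - 1))./2 *
    (\prod_(i in I) \prod_(j in ~: I) ((t * x i - x j) / (x i - x j)))
    * vdm x = vdm (fun k => if k \in I then t * x k else x k).
Proof.
pose B i j := if (i \in I) && (j \notin I)
  then (t * x i - x j) / (x i - x j) else 1.
pose C i j := if (i \in I) && (j \in I) then t else 1.
(* [B] is not symmetric: a pair i < j may be split with either index in I, so both orders are
   collected. *)
have EB : \prod_(i in I) \prod_(j in ~: I) ((t * x i - x j) / (x i - x j))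
    = (\prod_(i < n) \prod_(j < n | (i < j)%N) B i j)
      * (\prod_(i < n) \prod_(j < n | (i < j)%N) B j i).
  rewrite [X in _ * X](exchange_big_dep predT) //= -big_split /=.
  rewrite big_mkcond; apply: eq_bigr => i _.
  transitivity (\prod_(j < n) B i j).
    case: ifP => iI; last by rewrite big1 // => j _; rewrite /B iI.
    by rewrite big_mkcond; apply: eq_bigr => j _; rewrite /B iI inE.
  rewrite (bigID (fun j : 'I_n => i < j)%N) /=; congr (_ * _).
  rewrite (bigID (fun j : 'I_n => j == i)) /= big1 ?mul1r.
    apply: eq_bigl => j.
    by rewrite -leqNgt [RHS]ltn_neqAle andbC.
  by move=> j /andP[_ /eqP->]; rewrite /B andbN.
have EC : t ^+ (#|I| * (#|I| - 1))./2 =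
    \prod_(i < n) \prod_(j < n | (i < j)%N) C i j.
  rewrite -card_pairs_lt -prodrXr big_mkcond; apply: eq_bigr => i _.
  case: ifP => iI; last by rewrite big1 // => j _; rewrite /C iI.
  rewrite -prodrXr big_mkcondl /=; apply: eq_bigr => j _.
  by rewrite /C iI expr1.
rewrite EB EC /vdm -!big_split /=; apply: eq_bigr => i _.
rewrite -!big_split /=; apply: eq_bigr => j ltij.
have nij : i != j by rewrite neq_ltn ltij.
have u1 := x_unit nij; have u2 : x j - x i \is a GRing.unit.
  by apply: x_unit; rewrite eq_sym.
rewrite /B /C; case: (i \in I); case: (j \in I) => /=; rewrite ?mulr1 ?mul1r //.
- by rewrite mulrBr.
- by rewrite -[x j - x i]opprB mulrN mulrVK // opprB.
- by rewrite mulrVK.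
Qed.

End VdmShift.

Section Macdonald3.
Variables (K : fieldType) (n : nat).
Hypothesis charK : [pchar K] =i pred0.
Local Notation MP := {mpoly K[n]}.
Local Notation L := {fraction MP}.
Local Notation series := (fps L).

Definition vdmX : MP := vdm (fun i => 'X_i).

Lemma subX_neq0 (i j : 'I_n) : i != j -> 'X_i - 'X_j != 0 :> MP.
Proof.
move=> ij; apply/eqP => /(congr1 (fun p => p@_(U_(i)))).
rewrite mcoeffB !mcoeffX mcoeff0 eqxx eq_mnm1 eq_sym (negbTE ij) subr0.
by move/eqP; rewrite oner_eq0.
Qed.

Lemma vdmX_neq0 : vdmX != 0.
Proof.
apply/prodf_neq0 => i _; apply/prodf_neq0 => j ij.
by apply: subX_neq0; rewrite neq_ltn ij orbT.
Qed.

Lemma poly_fun_vdm (y : 'I_n -> series) : poly_fun vdmX y = vdm y.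
Proof.
rewrite poly_funE /vdmX /vdm rmorph_prod; apply: eq_bigr => i _.
rewrite rmorph_prod; apply: eq_bigr => j _.
by rewrite rmorphB /= !mmapX !mmap1U.
Qed.

Lemma vdm_series_of : vdm (fun i => series_of ('X_i : MP)) = series_of vdmX.
Proof.
rewrite /vdmX /vdm /series_of !rmorph_prod; apply: eq_bigr => i _.
rewrite !rmorph_prod; apply: eq_bigr => j _.
by rewrite !rmorphB.
Qed.

Lemma series_of_unit (p : MP) : p != 0 -> series_of p \is a GRing.unit.
Proof.
by move=> p0; rewrite /series_of rmorph_unit // unitfE tofrac_eq0.
Qed.

(** The summand of I becomes the product of the series exp(beta h th_I) Delta and exp(h th_I) f;
    take its coefficient of h^k. *)
Lemma macdonald_order_vdm (beta : K) (r k : nat) (f : MP) :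
  vdmX%:F * macdonald_order beta r k f =
  (\sum_(I : {set 'I_n} | #|I| == r) \sum_(a < k.+1)
     (beta ^+ a / (a`! * (k - a)`!)%:R) *:
       (iter a (thetas I) vdmX * iter (k - a) (thetas I) f))%:F.
Proof.
rewrite /macdonald_order -fps_coefCM -/(series_of vdmX) /macdonald.
rewrite [_ * (_ * _)]mulrCA.
rewrite !mulr_sumr fps_coef_sum rmorph_sum; apply: eq_bigr => I /eqP <-.
rewrite qshiftsE.
transitivity (fps_coef (poly_fun vdmX (shifted beta I) *
                        poly_fun f (shifted 1 I)) k).
  congr fps_coef; rewrite [poly_fun vdmX _]poly_fun_vdm.
  rewrite -[vdm _](@vdm_shift _ _ (fun i => series_of 'X_i)); last first.
    move=> i j ij; rewrite /series_of -!rmorphB; apply: series_of_unit.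
    exact: subX_neq0.
  rewrite vdm_series_of -!mulrA; congr (_ * _); rewrite mulrCA.
  by rewrite /shifted mpolyC1 tofrac1.
rewrite fps_coefM rmorph_sum; apply: eq_bigr => a _.
have Evdm := poly_fun_shifted charK beta I vdmX a.
have Ef := poly_fun_shifted charK 1 I f (k - a).
apply: etrans (congr2 *%R Evdm Ef) _.
rewrite expr1n -tofracM; congr tofrac; rewrite -scalerAl -scalerAr scalerA.
by rewrite natrM invfM div1r mulrA.
Qed.

End Macdonald3.

(** * Euler operators on the Vandermonde product *)

Section FieldIdentities.
Variable F : fieldType.
Implicit Types a b : F.

(** With a = x_i and b = x_j, the hypothesis is th_i applied to (x_i - x_j) p = x_i q, where p =
    u_ij q has been substituted; primes stand for th_i. *)
Lemma leibniz_ukern a b q q' p' : a - b != 0 ->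
  a * (a / (a - b) * q) + (a - b) * p' = a * q + a * q' ->
  p' = a / (a - b) * q' + a / (a - b) * (b / (b - a)) * q.
Proof.
move=> ab E; have ba : b - a != 0 by rewrite -opprB oppr_eq0.
by apply: (mulfI ab); move: E => /(canRL (addKr _)) ->; field; rewrite ab ba.
Qed.

Lemma leibniz_logder a a' p s : a != 0 ->
  a' * p + a * (p * s) = a * p * (a' / a + s).
Proof. by move=> a0; field. Qed.

Lemma logder_sub a b (i j : bool) : b - a != 0 ->
  (i%:R * b - j%:R * a) / (b - a) = i%:R * (b / (b - a)) + j%:R * (a / (a - b)).
Proof.
move=> ba; have ab : a - b != 0 by rewrite -opprB oppr_eq0.
by field; rewrite ab ba.
Qed.

Lemma ukern_cancel a b p : b - a != 0 ->
  a / (a - b) * ((b - a) * p) = - a * p.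
Proof.
move=> ba; have ab : a - b != 0 by rewrite -opprB oppr_eq0.
by field.
Qed.

Lemma ukern_cancel' a b p : a - b != 0 -> a / (a - b) * ((a - b) * p) = a * p.
Proof. by move=> ab; field. Qed.

End FieldIdentities.

Section VdmTheta.
Variables (K : fieldType) (n : nat).
Local Notation MP := {mpoly K[n]}.
Local Notation L := {fraction MP}.
Local Notation theta := (@theta n K).
Local Notation xF i := (('X_i : MP)%:F).
Implicit Types (p q : MP) (i j : 'I_n).

Definition power_sum k : K := \sum_(m < n) (m%:R) ^+ k.

Lemma iter_thetaXm i k (m : 'X_{1..n}) :
  iter k (theta i) 'X_[m] = (m i)%:R ^+ k *: 'X_[m].
Proof.
elim: k => [|k IH]; first by rewrite expr0 scale1r.
by rewrite iterS IH thetaZ thetaXm scalerA exprSr.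
Qed.

Lemma iter_theta_linear i k : linear (iter k (theta i)).
Proof. by elim: k => // k IH c p q; rewrite !iterS IH linearP. Qed.

(** Each monomial of the Vandermonde determinant has the exponents 0, ..., n-1 in some order, and
    th_i^k multiplies it by the k-th power of its exponent in x_i. *)
Lemma sum_iter_theta_vdm k :
  \sum_i iter k (theta i) (vdmX K n) = power_sum k *: vdmX K n.
Proof.
pose m (s : 'S_n) := [multinom nat_of_ord ((s^-1)%g i) | i < n].
have -> : vdmX K n = \sum_(s : 'S_n) (-1) ^+ s *: 'X_[m s].
  transitivity (\det (Vandermonde n (\row_i 'X_i : 'rV[MP]_n))).
    rewrite det_Vandermonde; apply: eq_bigr => i _; apply: eq_bigr => j _.
    by rewrite !mxE.
  apply: eq_bigr => s _; rewrite -mul_mpolyC rmorphXn rmorphN rmorph1.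
  congr (_ * _); rewrite mpolyXE_id [RHS](reindex_inj (@perm_inj _ s)) /=.
  by apply: eq_bigr => i _; rewrite !mxE mnmE permK.
have lin : linear (fun p => \sum_i iter k (theta i) p).
  move=> c p q; rewrite scaler_sumr -big_split; apply: eq_bigr => i _.
  exact: iter_theta_linear.
pose Lin := GRing.isLinear.Build K MP MP *:%R _ lin.
pose T : {linear MP -> MP} := HB.pack (fun p => \sum_i iter k (theta i) p) Lin.
rewrite -[LHS]/(T _) linear_sum scaler_sumr; apply: eq_bigr => s _.
rewrite linearZ [RHS]scalerA mulrC -scalerA; congr (_ *: _) => /=.
under eq_bigr do rewrite iter_thetaXm.
rewrite -scaler_suml; congr (_ *: _).
rewrite (reindex_inj (@perm_inj _ s)) /=.
by apply: eq_bigr => i _; rewrite mnmE permK.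
Qed.

Local Notation u := (ukern (fun i : 'I_n => xF i)).

Lemma fracX_inj : injective (fun i : 'I_n => xF i).
Proof.
move=> i j /eqP; rewrite -subr_eq0 -tofracB tofrac_eq0 => E.
by apply/eqP/negP => /negP/(subX_neq0 K); rewrite E.
Qed.

Let sub_neq0 i j : i != j -> xF i - xF j != 0.
Proof. by move=> ij; rewrite -tofracB tofrac_eq0 subX_neq0. Qed.

(** As [theta] acts on polynomials only, the product rule for u_ij q is obtained by differentiating
    (x_i - x_j) p = x_i q. *)
Lemma theta_ukern i j p q : i != j -> p%:F = u i j * q%:F ->
  (theta i p)%:F = u i j * (theta i q)%:F + u i j * u j i * q%:F.
Proof.
move=> ij Ep; have ji : j != i by rewrite eq_sym.
have /(congr1 (theta i)) : ('X_i - 'X_j) * p = 'X_i * q.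
  apply/eqP; rewrite -tofrac_eq !tofracM tofracB Ep /ukern; apply/eqP.
  by rewrite mulrA [_ * (_ / _)]mulrC mulfVK ?sub_neq0.
rewrite !thetaM linearB /= !thetaX eqxx scale1r (negbTE ij) scale0r subr0.
move/(congr1 (@tofrac _)); rewrite !(tofracD, tofracM) tofracN Ep.
by apply: leibniz_ukern; apply: sub_neq0.
Qed.

Lemma theta_prod (I : Type) (s : seq I) (P : pred I) (G : I -> MP) i :
  (forall a, P a -> G a != 0) ->
  (theta i (\prod_(a <- s | P a) G a))%:F = (\prod_(a <- s | P a) G a)%:F
    * \sum_(a <- s | P a) (theta i (G a))%:F / (G a)%:F.
Proof.
move=> G0; elim: s => [|a s IH].
  by rewrite !big_nil mulr0 -[1]/(1%:MP) thetaC tofrac0.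
rewrite !big_cons; case: ifP => // Pa.
rewrite thetaM tofracD !tofracM IH.
by apply: leibniz_logder; rewrite tofrac_eq0 G0.
Qed.

(** Logarithmic derivative: among the factors of Delta only those joining i to some j contribute,
    each giving u_ij. *)
Lemma theta_vdm i : (theta i (vdmX K n))%:F = ksum u i * (vdmX K n)%:F.
Proof.
have ne (a b : 'I_n) : (a < b)%N -> ('X_b - 'X_a : MP) != 0.
  by move=> ab; rewrite subX_neq0 // neq_ltn ab orbT.
rewrite /vdmX /vdm theta_prod; last first.
  by move=> a _; apply/prodf_neq0 => b; apply: ne.
rewrite mulrC; congr (_ * _).
have E (a b : 'I_n) : (a < b)%N -> (theta i ('X_b - 'X_a))%:F / ('X_b - 'X_a)%:F
   = (b == i)%:R * u b a + (a == i)%:R * u a b.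
  move=> ab; have nab : a != b by rewrite neq_ltn ab.
  rewrite linearB /= !thetaX !tofracB -!mul_mpolyC !tofracM !mpolyC_nat.
  rewrite !rmorph_nat ![i == _]eq_sym.
  by apply: logder_sub; apply: sub_neq0; rewrite eq_sym.
transitivity (\sum_(a < n) \sum_(b < n | (a < b)%N)
    ((b == i)%:R * u b a + (a == i)%:R * u a b)).
  apply: eq_bigr => a _; rewrite theta_prod; last by move=> b; apply: ne.
  rewrite mulrAC mulfV ?mul1r.
    by apply: eq_bigr => b ab; rewrite E.
  by rewrite tofrac_eq0; apply/prodf_neq0 => b; apply: ne.
under eq_bigr do rewrite big_split /=.
rewrite big_split /= (exchange_big_dep predT) //=.
under [X in _ + X]eq_bigr do rewrite -mulr_sumr.
under eq_bigr do rewrite -mulr_sumr.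
rewrite !sum_deltal /ksum [RHS](bigID (fun b : 'I_n => (b < i)%N)) /=.
congr (_ + _); rewrite [RHS](bigD1 i) ?ltnn //= ukernii add0r.
by apply: eq_bigl => b; rewrite -leqNgt ltn_neqAle eq_sym andbC.
Qed.

Lemma ukern_vdm_poly i j : exists p, p%:F = u i j * (vdmX K n)%:F.
Proof.
have key (a b : 'I_n) : (a < b)%N ->
    exists p, vdmX K n = ('X_b - 'X_a) * p.
  move=> ab; exists ((\prod_(c < n | (a < c)%N && (c != b)) ('X_c - 'X_a)) *
    \prod_(d < n | d != a) \prod_(c < n | (d < c)%N) ('X_c - 'X_d)).
  by rewrite /vdmX /vdm (bigD1 a) //= (bigD1 b) //= !mulrA.
have [->|ij] := eqVneq i j; first by exists 0; rewrite ukernii mul0r tofrac0.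
have x0 := sub_neq0 ij.
have [lt|lt|/val_inj E] := ltngtP i j; last by rewrite E eqxx in ij.
- have [p ->] := key _ _ lt; exists (- 'X_i * p).
  rewrite !tofracM tofracN tofracB; apply/esym/ukern_cancel/sub_neq0.
  by rewrite eq_sym.
- have [p ->] := key _ _ lt; exists ('X_i * p).
  by rewrite !tofracM tofracB; apply/esym/ukern_cancel'.
Qed.

(** Since x_i - x_j divides Delta, th_i Delta is a sum of polynomials u_ij Delta, and [theta_ukern]
    differentiates each of them. *)
Lemma theta2_vdm i :
  (theta i (theta i (vdmX K n)))%:F = ksum2 u i * (vdmX K n)%:F.
Proof.
have [P EP] := choice (ukern_vdm_poly i).
have -> : theta i (vdmX K n) = \sum_j P j.
  apply/eqP; rewrite -tofrac_eq theta_vdm rmorph_sum /= /ksum mulr_suml.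
  by apply/eqP/esym; apply: eq_bigr => j _; rewrite EP.
rewrite linear_sum /= rmorph_sum /= /ksum2 expr2 mulrDl.
rewrite -mulrA {1}/ksum !mulr_suml -big_split /=; apply: eq_bigr => j _.
have [<-|ij] := eqVneq i j.
  have -> : P i = 0.
    by apply/eqP; rewrite -tofrac_eq0 EP ukernii mul0r.
  by rewrite linear0 tofrac0 ukernii !mul0r addr0.
by rewrite (theta_ukern ij (EP j)) theta_vdm /ksum mulr_suml.
Qed.

End VdmTheta.

(** * Dunkl operators on symmetric polynomials *)

Section DunklKernel.
Variables (K : fieldType) (n : nat) (beta : K).
Local Notation MP := {mpoly K[n]}.
Local Notation L := {fraction MP}.
Local Notation theta := (@theta n K).
Local Notation xF i := (('X_i : MP)%:F).
Local Notation u := (ukern (fun i : 'I_n => xF i)).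
Local Notation v := (ksum u).
Local Notation b := (beta%:MP%:F : L).
Local Notation Del := (vdmX K n).
Implicit Types (p q f : MP) (i j : 'I_n).

Lemma tofrac_sum (I : Type) (s : seq I) (P : pred I) (G : I -> MP) :
  (\sum_(i <- s | P i) G i)%:F = \sum_(i <- s | P i) (G i)%:F.
Proof. exact: rmorph_sum. Qed.

Let sub_neq0 i j : i != j -> xF i - xF j != 0.
Proof. by move=> ij; rewrite -tofracB tofrac_eq0 subX_neq0. Qed.

Lemma tofrac_divdiff i j p : i != j ->
  ('X_i * divdiff i j p)%:F = u i j * (p - exchange i j p)%:F.
Proof.
move=> ij; rewrite -divdiffP !tofracM tofracB.
by apply/esym/ukern_cancel'/sub_neq0.
Qed.

Lemma dunklE i p : dunkl beta i p =
  theta i p + beta *: \sum_(j | j != i) 'X_i * divdiff i j p.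
Proof. by rewrite /dunkl theta.unlock. Qed.

Lemma tofrac_dunkl i p : (dunkl beta i p)%:F =
  (theta i p)%:F + b * \sum_j u i j * (p - exchange i j p)%:F.
Proof.
rewrite dunklE tofracD tofracZ tofrac_sum; congr (_ + _ * _).
rewrite [RHS](bigD1 i) //= ukernii mul0r add0r.
by apply: eq_bigr => j ji; rewrite tofrac_divdiff // eq_sym.
Qed.

Lemma tofrac_theta_dunkl i p : (theta i (dunkl beta i p))%:F =
  (theta i (theta i p))%:F + b * \sum_j (u i j * (theta i (p - exchange i j p))%:F
    + u i j * u j i * (p - exchange i j p)%:F).
Proof.
rewrite dunklE thetaD thetaZ linear_sum tofracD tofracZ tofrac_sum.
congr (_ + _ * _); rewrite [RHS](bigD1 i) //= ukernii !mul0r !add0r.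
apply: eq_bigr => j; rewrite eq_sym => ij.
by apply: theta_ukern => //; apply: tofrac_divdiff.
Qed.

(** [divdiff] is a chosen quotient, determined for i != j by cancelling x_i - x_j; conjugating the
    transposition of i, j by s gives that of s i, s j. *)
Lemma msym_divdiff (s : 'S_n) i j p : i != j ->
  msym s (divdiff i j p) = divdiff (s i) (s j) (msym s p).
Proof.
move=> ij; have sij : s i != s j by rewrite (inj_eq perm_inj).
apply: (mulfI (subX_neq0 K sij)); rewrite divdiffP -!msymXi -msymB -msymM.
rewrite divdiffP msymB /exchange -!msymMm; congr (_ - msym _ p).
by rewrite -tpermJ -conjgC.
Qed.

Lemma msym_dunkl (s : 'S_n) i p :
  msym s (dunkl beta i p) = dunkl beta (s i) (msym s p).
Proof.
rewrite !dunklE msymD msymZ msym_theta; congr (_ + _ *: _).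
rewrite (raddf_sum (msym s)) [RHS](reindex_inj (@perm_inj _ s)) /=.
apply: eq_big => j; first by rewrite (inj_eq perm_inj).
by rewrite eq_sym => ij; rewrite msymM msymXi msym_divdiff.
Qed.

Section Symmetric.
Variable f : MP.
Hypothesis f_sym : f \is symmetric.

Lemma exchange_sym i j : exchange i j f = f.
Proof. exact: (issymP _ f_sym). Qed.

Lemma exchange_theta i j : exchange i j (theta i f) = theta j f.
Proof. by rewrite /exchange msym_theta tpermL (issymP _ f_sym). Qed.

Lemma dunkl_sym i : dunkl beta i f = theta i f.
Proof.
apply/eqP; rewrite -tofrac_eq tofrac_dunkl big1 ?mulr0 ?addr0 // => j _.
by rewrite exchange_sym subrr tofrac0 mulr0.
Qed.

(** By equivariance of the Dunkl operators; since d_i f = th_i f, this says K_ij d_i^2 f = d_j^2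
    f. *)
Lemma exchange_dunkl i j :
  exchange i j (dunkl beta i (theta i f)) = dunkl beta j (theta j f).
Proof. by rewrite /exchange msym_dunkl tpermL [msym _ _]exchange_theta. Qed.

Lemma sum_theta_sym : \sum_i theta i f \is symmetric.
Proof.
apply/issymP => s; rewrite (raddf_sum (msym s)) /=.
rewrite [RHS](reindex_inj (@perm_inj _ s)) /=.
by apply: eq_bigr => i _; rewrite msym_theta (issymP _ f_sym).
Qed.

Lemma dunklH1 : dunklH beta 1 f = \sum_i theta i f.
Proof. by apply: eq_bigr => i _; apply: dunkl_sym. Qed.

Lemma tofrac_dunkl2 i : (dunkl beta i (theta i f))%:F =
  (theta i (theta i f))%:F
  + b * \sum_j u i j * ((theta i f)%:F - (theta j f)%:F).
Proof.
rewrite tofrac_dunkl; congr (_ + _ * _); apply: eq_bigr => j _.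
by rewrite exchange_theta tofracB.
Qed.

Lemma tofrac_dunklH2 : (dunklH beta 2 f)%:F =
  \sum_i (theta i (theta i f))%:F + b * (2 * (\sum_i v i * (theta i f)%:F)
    - (n%:R - 1) * \sum_i (theta i f)%:F).
Proof.
rewrite /dunklH tofrac_sum.
under eq_bigr do rewrite /= dunkl_sym tofrac_dunkl2.
rewrite big_split /= -mulr_sumr; congr (_ + _ * _).
by apply: sum_ukern_sub; apply: ukernC; apply: fracX_inj.
Qed.

Lemma tofrac_dunklH3 : 2 * (dunklH beta 3 f)%:F =
  2 * (\sum_i (theta i (theta i (theta i f)))%:F)
  + 6 * b * (\sum_i v i * (theta i (theta i f))%:F)
  + 6 * b ^+ 2 * (\sum_i ksum2 u i * (theta i f)%:F)
  - b * (\sum_i \sum_j (theta i (theta j f))%:F)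
  - b * (2 * n%:R - 3) * (\sum_i (theta i (theta i f))%:F
       + 2 * b * \sum_i v i * (theta i f)%:F)
  - 2 * b ^+ 2 * (n%:R - 1) * (\sum_i (theta i f)%:F).
Proof.
rewrite -(@dunkl3_kernel _ _ u _ _ _ b (fun i => (theta i f)%:F)
  (fun i j => (theta i (theta j f))%:F)); first last.
- by move=> i j; rewrite theta_comm.
- by apply: ukern_triple; apply: fracX_inj.
- by apply: ukernC; apply: fracX_inj.
- exact: ukernii.
congr (2 * _); rewrite /dunklH tofrac_sum; apply: eq_bigr => i _ /=.
(* In d_i (d_i th_i f) the outer operator splits into th_i, carried through the inner one, and an
   exchange part. *)
rewrite dunkl_sym tofrac_dunkl tofrac_theta_dunkl; congr (_ + _ * _ + _ * _).
  apply: eq_bigr => j _.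
  by rewrite exchange_theta linearB /= !tofracB.
apply: eq_bigr => j _; rewrite exchange_dunkl tofracB.
by congr (_ * (_ - _)); apply: tofrac_dunkl2.
Qed.

End Symmetric.

End DunklKernel.

(** * Sums over r-subsets *)

(** Complements of such I are the subsets of size #|T| - r of the complement of A. With r - #|A| as
    lower index, truncated subtraction would give 1 instead of 0 when A has more than r elements. *)
Lemma card_supersets (T : finType) (A : {set T}) r : (r <= #|T|)%N ->
  #|[set I : {set T} | (#|I| == r) && (A \subset I)]| = 'C(#|T| - #|A|, #|T| - r).
Proof.
move=> le_rT; have -> : (#|T| - #|A| = #|~: A|)%N by rewrite [RHS]cardsCs setCK.
rewrite -cards_draws.
rewrite -(card_imset _ (@setC_inj T)); apply: eq_card => J.
rewrite -[J in LHS]setCK (mem_imset _ _ (@setC_inj T)) !inE.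
rewrite -setCS setCK andbC; congr (_ && _).
by have := cardsC J; move: #|~: J| #|J| #|T| le_rT => a b c; lia.
Qed.

Section SubsetSums.
Variables (K : fieldType) (V : lmodType K) (n r : nat).
Hypothesis le_rn : (r <= n)%N.

Let S p : K := 'C(n - p, n - r)%:R.

Lemma sum_subsets3 (W : 'I_n -> 'I_n -> 'I_n -> V) :
  \sum_(I : {set 'I_n} | #|I| == r)
    \sum_(i in I) \sum_(j in I) \sum_(k in I) W i j k =
  S 3 *: (\sum_i \sum_j \sum_k W i j k)
  + (S 2 - S 3) *: (\sum_i \sum_j (W i i j + W i j i + W j i i))
  + (S 1 - 3 * S 2 + 2 * S 3) *: (\sum_i W i i i).
Proof.
pose c (i j k : 'I_n) : K := S #|[set i; j; k]|.
(* The number of equalities among i, j, k is 0, 1 or 3, and the three coefficients interpolate the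
   values S 3, S 2, S 1. *)
have cE i j k : c i j k = S 3 + (S 2 - S 3)
      * ((i == j)%:R + (i == k)%:R + (j == k)%:R)
    + (S 1 - 3 * S 2 + 2 * S 3) * ((i == j)%:R * (i == k)%:R).
  rewrite /c -setUA cardsU1 cards2 !inE.
  have [->|ij] := eqVneq i j.
    by case: (eqVneq j k) => _ /=; ring.
  have [<-|ik] := eqVneq i k; first by rewrite eq_sym (negbTE ij) /=; ring.
  by case: eqVneq => _ /=; ring.
transitivity (\sum_i \sum_j \sum_k c i j k *: W i j k).
  transitivity (\sum_(I : {set 'I_n} | #|I| == r)
    \sum_i \sum_j \sum_k (if [set i; j; k] \subset I then W i j k else 0)).
    apply: eq_bigr => I _; rewrite big_mkcond; apply: eq_bigr => i _.
    case: ifP => iI; last first.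
      by rewrite big1 // => j _; rewrite big1 // => k _; rewrite !subUset !sub1set iI.
    rewrite big_mkcond; apply: eq_bigr => j _.
    case: ifP => jI; last first.
      by rewrite big1 // => k _; rewrite !subUset !sub1set iI jI.
    rewrite big_mkcond; apply: eq_bigr => k _.
    by rewrite !subUset !sub1set iI jI.
  rewrite exchange_big; apply: eq_bigr => i _.
  rewrite exchange_big; apply: eq_bigr => j _.
  rewrite exchange_big; apply: eq_bigr => k _.
  rewrite -big_mkcondr /= sumr_const scaler_nat; congr (_ *+ _).
  rewrite -[X in 'C(X - _, X - _)]card_ord -card_supersets ?card_ord //.
  by apply: eq_card => I; rewrite !inE.
have delta (f : 'I_n -> V) i : \sum_j (i == j)%:R *: f j = f i.
  rewrite (bigD1 i) //= eqxx scale1r big1 ?addr0 // => j.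
  by rewrite eq_sym => /negbTE->; rewrite scale0r.
have -> : \sum_i \sum_j (W i i j + W i j i + W j i i) =
    \sum_i \sum_j \sum_k ((i == j)%:R + (i == k)%:R + (j == k)%:R) *: W i j k.
  transitivity (\sum_i \sum_j W i i j + \sum_i \sum_j W i j i
     + \sum_i \sum_j W i j j).
    rewrite [X in _ = _ + X]exchange_big -!big_split; apply: eq_bigr => i _.
    by rewrite -!big_split.
  rewrite -!big_split; apply: eq_bigr => i _ /=.
  under [RHS]eq_bigr do under eq_bigr do rewrite !scalerDl.
  under [RHS]eq_bigr do rewrite !big_split /= -scaler_sumr !delta.
  by rewrite !big_split /= delta.
have -> : \sum_i W i i i =
    \sum_i \sum_j \sum_k ((i == j)%:R * (i == k)%:R) *: W i j k.
  apply: eq_bigr => i _.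
  under [RHS]eq_bigr do under eq_bigr do rewrite -scalerA.
  under [RHS]eq_bigr do rewrite -scaler_sumr delta.
  by rewrite delta.
rewrite !scaler_sumr -!big_split; apply: eq_bigr => i _ /=.
rewrite !scaler_sumr -!big_split; apply: eq_bigr => j _ /=.
rewrite !scaler_sumr -!big_split; apply: eq_bigr => k _ /=.
by rewrite !scalerA -!scalerDl cE.
Qed.

End SubsetSums.

(** * Binomial coefficients as multiples of [coefH11] *)

Section Binomials.
Variables (K : fieldType) (n r : nat).
Hypothesis charK : [pchar K] =i pred0.
Hypotheses (n_ge3 : (3 <= n)%N) (r_bounds : (1 <= r <= n)%N).
Let N : K := n%:R.
Let r' : K := r%:R.
Local Notation kap := (coefH11 K n r).

Let natK m : (0 < m)%N -> m%:R != 0 :> K.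
Proof. exact: natf_neq0_pchar0. Qed.

(** Both sides are (n-1-i-j)! / ((r-1-j)! (n-r-i)!); the falling factorials shorten the factorials
    in the denominator of [coefH11]. *)
Lemma binE_kap i j : (i <= n - r)%N -> (j < r)%N ->
  'C(n - 1 - (i + j), r - 1 - j)%:R
  = kap * ((n - 1 - (i + j))`!%:R / (n - 3)`!%:R) * ((n - r) ^_ i * (r - 1) ^_ j)%:R.
Proof.
move=> le_i lt_j.
have fi := ffact_fact le_i.
have le_j : (j <= r - 1)%N by lia.
have fj := ffact_fact le_j.
have le_b : (r - 1 - j <= n - 1 - (i + j))%N by lia.
have := bin_fact le_b.
have -> : (n - 1 - (i + j) - (r - 1 - j) = n - r - i)%N by lia.
move=> fb; rewrite /coefH11 -fi -fj -fb.
have := natK (fact_gt0 (n - r - i)); have := natK (fact_gt0 (r - 1 - j)).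
have := natK (fact_gt0 (n - 3)).
have : ((n - r) ^_ i)%:R != 0 :> K by rewrite natK ?ffact_gt0.
have : ((r - 1) ^_ j)%:R != 0 :> K by rewrite natK ?ffact_gt0.
by rewrite !natrM => a1 a2 a3 a4 a5; field; rewrite a1 a2 a3 a4 a5.
Qed.

Let natB a b : (b <= a)%N -> (a - b)%:R = a%:R - b%:R :> K.
Proof. exact: natrB. Qed.

Let ratio1 : (n - 1)`!%:R / (n - 3)`!%:R = (N - 1) * (N - 2) :> K.
Proof.
have -> : (n - 1 = (n - 3).+2)%N by lia.
rewrite !factS !natrM -[(n - 3).+2]/(2 + (n - 3))%N -[(n - 3).+1]/(1 + (n - 3))%N.
rewrite !natrD natB // -/N; field; exact: natK (fact_gt0 _).
Qed.

Let ratio2 : (n - 2)`!%:R / (n - 3)`!%:R = N - 2 :> K.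
Proof.
have -> : (n - 2 = (n - 3).+1)%N by lia.
rewrite !factS !natrM -[(n - 3).+1]/(1 + (n - 3))%N.
rewrite !natrD natB // -/N; field; exact: natK (fact_gt0 _).
Qed.

Let ratio3 : (n - 3)`!%:R / (n - 3)`!%:R = 1 :> K.
Proof. by rewrite divff // natK // fact_gt0. Qed.

Let natnr : (n - r)%:R = N - r' :> K.
Proof. by rewrite natB //; case/andP: r_bounds. Qed.

Let natrm1 : (r - 1)%:R = r' - 1 :> K.
Proof. by rewrite natB //; case/andP: r_bounds. Qed.

Let natffact2 m : (m ^_ 2)%:R = m%:R * (m%:R - 1) :> K.
Proof.
rewrite ffactnS ffactn1 natrM; case: m => [|m]; first by rewrite !mul0r.
by rewrite /= -natr1 addrK.
Qed.

Lemma bin_kap1 : 'C(n - 1, r - 1)%:R = kap * (N - 1) * (N - 2).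
Proof.
have := @binE_kap 0 0 isT; rewrite !ffactn0 !subn0 mulr1 ratio1 mulrA.
by apply; case/andP: r_bounds.
Qed.

Lemma bin_kap2l : 'C(n - 2, r - 1)%:R = kap * (N - 2) * (N - r').
Proof.
have [le|lt] := leqP 1 (n - r); last first.
  (* Here [binE_kap] does not apply, but both sides vanish: r - 1 exceeds n - 2, and N - r' = 0. *)
  have e : n = r by lia.
  by rewrite bin_small; last lia; rewrite /N /r' e subrr mulr0.
have := @binE_kap 1 0 le; rewrite ffactn0 ffactn1 muln1 !subn0 addn0 -subnDA.
by rewrite ratio2 natnr; apply; lia.
Qed.

Lemma bin_kap2r : 'C(n - 2, n - r)%:R = kap * (N - 2) * (r' - 1).
Proof.
have [le|lt] := ltnP 1 r; last first.
  have e : r = 1%N by lia.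
  by rewrite bin_small; last lia; rewrite /r' e subrr mulr0.
have := @binE_kap 0 1 isT le; rewrite ffactn0 ffactn1 mul1n add0n -!subnDA.
rewrite ratio2 natrm1 => <-; rewrite -bin_sub; last lia.
by congr ('C(_, _)%:R); lia.
Qed.

Lemma bin_kap3l : (1 < r)%N -> 'C(n - 3, r - 2)%:R = kap * (N - r') * (r' - 1).
Proof.
move=> lt1r; have [le|lt] := leqP 1 (n - r); last first.
  have e : n = r by lia.
  by rewrite bin_small; last lia; rewrite /N /r' e subrr mulr0 mul0r.
have := @binE_kap 1 1 le lt1r; rewrite !ffactn1 -!subnDA natrM natnr natrm1.
by rewrite ratio3 => ->; rewrite mulr1 mulrA.
Qed.

Lemma bin_kap3r : 'C(n - 3, n - r)%:R = kap * (r' - 1) * (r' - 2).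
Proof.
have [le|lt] := ltnP 2 r; last first.
  rewrite bin_small; last lia.
  by have [e|e] : r = 1%N \/ r = 2%N by [lia|]; rewrite /r' e subrr ?mulr0 ?mul0r.
have := @binE_kap 0 2 isT le; rewrite ffactn0 mul1n add0n -!subnDA natffact2 natrm1.
rewrite ratio3 mulr1 -addrA -opprD -[1 + 1]/(2%:R) mulrA => <-.
rewrite -bin_sub; last lia.
by congr ('C(_, _)%:R); lia.
Qed.

Lemma bin_kap0 : 'C(n, r)%:R = kap * N * (N - 1) * (N - 2) / r'.
Proof.
have r0 : r' != 0 by apply: natK; case/andP: r_bounds.
apply: (mulIf r0); rewrite mulfVK // -natrM mulnC.
have -> : (r * 'C(n, r) = n * 'C(n - 1, r - 1))%N.
  have -> : n = (n - 1).+1 by lia.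
  have -> : r = (r - 1).+1 by lia.
  by rewrite -mul_bin_diag !subn1.
by rewrite natrM bin_kap1 -/N; ring.
Qed.

(** For r > 1 the factor r - 1 of [bin_kap3l] cancels. For r = 1 the coefficient is 1 and [coefH11]
    is 1 / ((n-1)(n-2)), so one formula covers both readings. *)
Lemma coefH3_kap : coefH3 K n r = kap * (N - r') * (N - 2 * r').
Proof.
rewrite /coefH3 -/N -/r'; case: eqP => [e|/eqP r1].
  rewrite e /= bin0 /r' e /coefH11 subnn fact0.
  have -> : (n - 1)`!%:R = (n - 3)`!%:R * ((N - 1) * (N - 2)) :> K.
    by rewrite -ratio1 mulrC divfK // natK // fact_gt0.
  have h1 : N - 1 != 0 by rewrite -[_ - _](@natB n 1) ?natK; lia.
  have h2 : N - 2 != 0 by rewrite -[_ - _](@natB n 2) ?natK; lia.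
  have h3 := natK (fact_gt0 (n - 3)).
  by field; rewrite h1 h2 h3.
have lt1r : (1 < r)%N by lia.
have -> : binomz (n - 3) (r%:Z - 2) = 'C(n - 3, r - 2).
  by have -> : r%:Z - 2 = (r - 2)%N by lia.
have h1 : r' - 1 != 0 by rewrite -natrm1 natK //; lia.
by rewrite bin_kap3l //; field.
Qed.

Lemma binomz_kap2 :
  (binomz (n - 2) (r%:Z - 1))%:R = kap * (N - 2) * (N - r').
Proof.
have -> : r%:Z - 1 = (r - 1)%N by lia.
exact: bin_kap2l.
Qed.

Lemma binomz_kap1 :
  (binomz (n - 1) (r%:Z - 1))%:R = kap * (N - 1) * (N - 2).
Proof.
have -> : r%:Z - 1 = (r - 1)%N by lia.
exact: bin_kap1.
Qed.

Lemma binomz_kap3l :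
  (binomz (n - 3) (r%:Z - 2))%:R = kap * (N - r') * (r' - 1).
Proof.
have [lt|le] := ltnP 1 r; last first.
  have e : r = 1%N by lia.
  by rewrite /r' e subrr mulr0.
have -> : r%:Z - 2 = (r - 2)%N by lia.
exact: bin_kap3l.
Qed.

Lemma binomz_kap3r :
  (binomz (n - 3) (r%:Z - 3))%:R = kap * (r' - 1) * (r' - 2).
Proof.
have [lt|le] := ltnP 2 r; last first.
  by have [e|e] : r = 1%N \/ r = 2%N by [lia|]; rewrite /r' e subrr ?mulr0 ?mul0r.
have -> : r%:Z - 3 = (r - 3)%N by lia.
rewrite -bin_kap3r /= -bin_sub; last lia.
by congr ('C(_, _)%:R); lia.
Qed.

End Binomials.

(** * The third order *)

(** D is Delta; E1, E2, E3 are H_1 f, H_1^2 f, H_1^3 f; T2, T3 are the sums of th_i^2 f, th_i^3 f;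
    V1, V2, V3 are the sums of th_i Delta * th_i f, th_i Delta * th_i^2 f, th_i^2 Delta * th_i f.
    H2E, T2E, V1E are H2, T2, V1 with H_1 f in place of f. Once the T's are solved for, V2 and V3
    cancel against T3, V1E against T2E, and V1 occurs only in D T2 + 2 beta V1. *)
Lemma third_order_identity (K F : fieldType) (io : {rmorphism K -> F})
    (N r kap beta d p2 p3 : K)
    (D H3 H2 H2E E3 E2 E1 f V1 V1E V2 V3 T2 T2E T3 : F) :
  2 != 0 :> K -> 3 != 0 :> K -> N - 2 != 0 -> r != 0 -> D != 0 ->
  d = N * (N - 1) / 2 -> p2 = N * (N - 1) * (2 * N - 1) / 6 ->
  p3 = N ^+ 2 * (N - 1) ^+ 2 / 4 ->
  D * H2 = D * T2 + io beta * (2 * V1 - (io N - 1) * (D * E1)) ->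
  D * H2E = D * T2E + io beta * (2 * V1E - (io N - 1) * (D * E2)) ->
  2 * (D * H3) = 2 * (D * T3) + 6 * io beta * V2 + 6 * io beta ^+ 2 * V3
    - io beta * (D * E2) - io beta * (2 * io N - 3) * (D * T2 + 2 * io beta * V1)
    - 2 * io beta ^+ 2 * (io N - 1) * (D * E1) ->
  let S3 := kap * (r - 1) * (r - 2) in
  let S21 := kap * (N - r) * (r - 1) in
  let S111 := kap * (N - r) * (N - 2 * r) in
  io (1 / 6) * (D * (io S3 * E3 + io S21 * (3 * T2E) + io S111 * T3))
  + io (beta / 2) * (io S3 * (io d * D * E2)
       + io S21 * (2 * V1E + io d * D * T2) + io S111 * V2)
  + io (beta ^+ 2 / 2) * (io S3 * (io d * (io d * D) * E1)
       + io S21 * (io p2 * D * E1 + 2 * (io d * V1)) + io S111 * V3)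
  + io (beta ^+ 3 / 6) * ((io S3 * (io d * (io d * (io d * D)))
       + io S21 * (3 * (io d * (io p2 * D))) + io S111 * (io p3 * D)) * f)
  = D * (io (1 / 6 * (kap * (N - r) * (N - 2 * r))) * H3
    + io (1 / 2 * (kap * (N - r) * (r - 1))) * H2E
    + io ((N ^+ 2 * (3 * r - 1) - 7 * r * N + 6 * r) / (12 * (N - 2))
          * (kap * (N - 2) * (N - r)) * beta) * H2
    + io (1 / 6 * (kap * (r - 1) * (r - 2))) * E3
    + io (beta / 12 * kap * ((3 * r ^+ 2 - 3 * r + 1) * N ^+ 2
            + (- 9 * r ^+ 2 + 6 * r) * N + 8 * r ^+ 2 - 6 * r)) * E2
    + io (beta ^+ 2 * r / 24 * ((3 * r + 1) * N ^+ 2 + (1 - 7 * r) * N + 2 * r)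
         * (kap * (N - 1) * (N - 2))) * E1
    + io (beta ^+ 3 * (kap * N * (N - 1) * (N - 2) / r)
         * (r ^+ 2 * N * (N - 1) / 48) * ((r + 1) * N + 1 - 3 * r)) * f).
Proof.
move=> two3 three N2 r0 D0 -> -> -> /= eH2 eH2E eH3.
have io2 : 2 != 0 :> F by rewrite -(rmorph_nat io) fmorph_eq0.
have io3 : 3 != 0 :> F by rewrite -(rmorph_nat io) fmorph_eq0.
have ioN2 : io N - 2 != 0.
  by rewrite -(rmorph_nat io) -rmorphB fmorph_eq0.
have ior : io r != 0 by rewrite fmorph_eq0.
have eT2 : T2 = H2 - io beta * (2 * V1 - (io N - 1) * (D * E1)) / D.
  by apply: (mulfI D0); rewrite mulrBr eH2; field.
have eT2E : T2E = H2E - io beta * (2 * V1E - (io N - 1) * (D * E2)) / D.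
  by apply: (mulfI D0); rewrite mulrBr eH2E; field.
have eT3 : T3 = H3 - (6 * io beta * V2 + 6 * io beta ^+ 2 * V3
    - io beta * (D * E2) - io beta * (2 * io N - 3) * (D * T2 + 2 * io beta * V1)
    - 2 * io beta ^+ 2 * (io N - 1) * (D * E1)) / (2 * D).
  apply: (mulfI D0); apply: (mulfI io2); rewrite mulrBr [2 * (_ - _)]mulrBr eH3.
  by field; rewrite D0 io2.
rewrite eT3 eT2E eT2.
(* Every numerical denominator is a product of powers of 2 and 3. *)
have num a c : 2 ^+ a * 3 ^+ c != 0 :> F by rewrite mulf_neq0 ?expf_neq0.
have n48 : 48 != 0 :> F by rewrite (_ : 48 = 2 ^+ 4 * 3 ^+ 1) ?num //; ring.
have n24 : 24 != 0 :> F by rewrite (_ : 24 = 2 ^+ 3 * 3 ^+ 1) ?num //; ring.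
have n12 : 12 != 0 :> F by rewrite (_ : 12 = 2 ^+ 2 * 3 ^+ 1) ?num //; ring.
have n6 : 6 != 0 :> F by rewrite (_ : 6 = 2 ^+ 1 * 3 ^+ 1) ?num //; ring.
have n4 : 4 != 0 :> F by rewrite (_ : 4 = 2 ^+ 2 * 3 ^+ 0) ?num //; ring.
by field; rewrite n48 ior n24 n12 n6 ioN2 io2 n4 D0.
Qed.

Section PowerSums.
Variables (K : fieldType) (n : nat).
Hypothesis charK : [pchar K] =i pred0.
Let N : K := n%:R.

Let natK m : (0 < m)%N -> m%:R != 0 :> K.
Proof. exact: natf_neq0_pchar0. Qed.

Lemma power_sum1 : power_sum K n 1 = N * (N - 1) / 2.
Proof.
have n2 := natK (isT : 0 < 2)%N.
rewrite /power_sum /N; elim: n => [|m IH]; first by rewrite big_ord0; ring.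
by rewrite big_ord_recr /= IH -natr1; field.
Qed.

Lemma power_sum2 : power_sum K n 2 = N * (N - 1) * (2 * N - 1) / 6.
Proof.
have n6 := natK (isT : 0 < 6)%N.
rewrite /power_sum /N; elim: n => [|m IH]; first by rewrite big_ord0; ring.
by rewrite big_ord_recr /= IH -natr1; field.
Qed.

Lemma power_sum3 : power_sum K n 3 = N ^+ 2 * (N - 1) ^+ 2 / 4.
Proof.
have n4 := natK (isT : 0 < 4)%N.
rewrite /power_sum /N; elim: n => [|m IH]; first by rewrite big_ord0; ring.
by rewrite big_ord_recr /= IH -natr1; field.
Qed.

End PowerSums.

Section ClearedRelations.
Variable R : comPzRingType.

Lemma clear_dunkl2 (D H T b v N E : R) : H = T + b * (2 * v - (N - 1) * E) ->
  D * H = D * T + b * (2 * (D * v) - (N - 1) * (D * E)).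
Proof. by move=> ->; ring. Qed.

Lemma clear_dunkl3 (D H T3 T2 b v2 v3 v N E2 E : R) :
  2 * H = 2 * T3 + 6 * b * v2 + 6 * b ^+ 2 * v3 - b * E2
    - b * (2 * N - 3) * (T2 + 2 * b * v) - 2 * b ^+ 2 * (N - 1) * E ->
  2 * (D * H) = 2 * (D * T3) + 6 * b * (D * v2) + 6 * b ^+ 2 * (D * v3)
    - b * (D * E2) - b * (2 * N - 3) * (D * T2 + 2 * b * (D * v))
    - 2 * b ^+ 2 * (N - 1) * (D * E).
Proof. by move=> E3; rewrite [LHS]mulrCA E3; ring. Qed.

End ClearedRelations.

(** * Sums over I of three Euler operators distributed over Delta and f *)

Section ThirdOrder.
Variables (K : fieldType) (n r : nat) (beta : K).
Hypothesis charK : [pchar K] =i pred0.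
Hypothesis le_rn : (r <= n)%N.
Local Notation MP := {mpoly K[n]}.
Local Notation L := {fraction MP}.
Local Notation theta := (@theta n K).
Local Notation euler p := (\sum_i theta i p).
Local Notation Del := (vdmX K n).
Local Notation d := (power_sum K n 1).
Local Notation p2 := (power_sum K n 2).
Local Notation p3 := (power_sum K n 3).
Implicit Types (p q f : MP) (i j : 'I_n).

Let S m : K := 'C(n - m, n - r)%:R.
Let S3 := S 3.
Let S21 := S 2 - S 3.
Let S111 := S 1 - 3 * S 2 + 2 * S 3.

Lemma euler_theta i p : euler (theta i p) = theta i (euler p).
Proof. by rewrite linear_sum; apply: eq_bigr => j _; rewrite theta_comm. Qed.

Lemma euler_vdm : euler Del = d *: Del.
Proof. exact: (sum_iter_theta_vdm K n 1). Qed.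

Lemma euler_theta_vdm i : euler (theta i Del) = d *: theta i Del.
Proof. by rewrite euler_theta euler_vdm thetaZ. Qed.

Lemma thetas2 I p : thetas I (thetas I p) =
  \sum_(i in I) \sum_(j in I) theta i (theta j p).
Proof. by apply: eq_bigr => i _; rewrite linear_sum. Qed.

Lemma thetas3 I p : thetas I (thetas I (thetas I p)) =
  \sum_(i in I) \sum_(j in I) \sum_(k in I) theta i (theta j (theta k p)).
Proof.
rewrite {1}/thetas; apply: eq_bigr => i _; rewrite thetas2 linear_sum.
by apply: eq_bigr => j _; rewrite linear_sum.
Qed.

Local Notation sum3 W := (S3 *: (\sum_i \sum_j \sum_k W i j k)
  + S21 *: (\sum_i \sum_j (W i i j + W i j i + W j i i))
  + S111 *: (\sum_i W i i i)).

Lemma sum_theta2 p : \sum_i \sum_j theta i (theta j p) = euler (euler p).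
Proof. by apply: eq_bigr => i _; rewrite linear_sum. Qed.

Lemma sum_theta3 p :
  \sum_i \sum_j \sum_k theta i (theta j (theta k p)) = euler (euler (euler p)).
Proof.
rewrite -sum_theta2; apply: eq_bigr => i _; apply: eq_bigr => j _.
by rewrite !linear_sum.
Qed.

Lemma sum_theta21 p :
  \sum_i \sum_j theta i (theta i (theta j p)) = \sum_i theta i (theta i (euler p)).
Proof. by apply: eq_bigr => i _; rewrite !linear_sum. Qed.

Lemma sum_split3 (A B C : 'I_n -> 'I_n -> MP) :
  \sum_i \sum_j (A i j + B i j + C j i) =
  \sum_i \sum_j A i j + \sum_i \sum_j B i j + \sum_i \sum_j C i j.
Proof.
rewrite [X in _ = _ + X]exchange_big -!big_split; apply: eq_bigr => i _.
by rewrite -!big_split.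
Qed.

Lemma subset_sum3 p :
  \sum_(I : {set 'I_n} | #|I| == r) thetas I (thetas I (thetas I p)) =
  S3 *: euler (euler (euler p))
  + S21 *: (3 * \sum_i theta i (theta i (euler p)))
  + S111 *: (\sum_i theta i (theta i (theta i p))).
Proof.
pose W i j k := theta i (theta j (theta k p)).
transitivity (sum3 W).
  by rewrite -sum_subsets3 //; apply: eq_bigr => I _; rewrite thetas3.
congr (_ *: _ + _ *: _ + _); first exact: sum_theta3.
transitivity (\sum_i \sum_j 3 * theta i (theta i (theta j p))).
  apply: eq_bigr => i _; apply: eq_bigr => j _; rewrite /W.
  rewrite (theta_comm j i p) (theta_comm j i (theta i p)).
  by rewrite (theta_comm j i p); ring.
by rewrite -sum_theta21 mulr_sumr; apply: eq_bigr => i _; rewrite mulr_sumr.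
Qed.

(** The coincidences i = j and i = k both pair th_i Delta with th_i of the Euler sum of f; j = k
    leaves the full sum of th_i Delta, which is d Delta. *)
Lemma subset_sum12 f :
  \sum_(I : {set 'I_n} | #|I| == r) thetas I Del * thetas I (thetas I f) =
  S3 *: (d *: Del * euler (euler f))
  + S21 *: (2 * (\sum_i theta i Del * theta i (euler f))
            + d *: Del * \sum_i theta i (theta i f))
  + S111 *: (\sum_i theta i Del * theta i (theta i f)).
Proof.
pose W i j k := theta i Del * theta j (theta k f).
transitivity (sum3 W).
  rewrite -sum_subsets3 //; apply: eq_bigr => I _; rewrite thetas2 mulr_suml.
  by apply: eq_bigr => i _; rewrite mulr_sumr; apply: eq_bigr => j _; rewrite mulr_sumr.
congr (_ *: _ + _ *: _ + _ *: _).
- rewrite -sum_theta2 -euler_vdm mulr_suml; apply: eq_bigr => i _.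
  by rewrite mulr_sumr; apply: eq_bigr => j _; rewrite mulr_sumr.
- rewrite (sum_split3 (fun i j => W i i j) (fun i j => W i j i) (fun i j => W i j j)).
  congr (_ + _).
    rewrite mulr_natl mulr2n; congr (_ + _); apply: eq_bigr => i _;
      rewrite linear_sum mulr_sumr //; apply: eq_bigr => j _.
    by rewrite /W theta_comm.
  rewrite -euler_vdm mulr_suml; apply: eq_bigr => i _.
  by rewrite mulr_sumr.
Qed.

(** Now i = j leaves p2 Delta, while i = k and j = k leave one full Euler sum on th_i Delta, which
    acts as d. *)
Lemma subset_sum21 f :
  \sum_(I : {set 'I_n} | #|I| == r) thetas I (thetas I Del) * thetas I f =
  S3 *: (d *: (d *: Del) * euler f)
  + S21 *: (p2 *: Del * euler f + 2 * (d *: \sum_i theta i Del * theta i f))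
  + S111 *: (\sum_i theta i (theta i Del) * theta i f).
Proof.
have p2E : \sum_i theta i (theta i Del) = p2 *: Del.
  exact: (sum_iter_theta_vdm K n 2).
pose W i j k := theta i (theta j Del) * theta k f.
transitivity (sum3 W).
  rewrite -sum_subsets3 //; apply: eq_bigr => I _; rewrite thetas2 mulr_suml.
  apply: eq_bigr => i _; rewrite mulr_suml; apply: eq_bigr => j _.
  by rewrite mulr_sumr.
congr (_ *: _ + _ *: _ + _ *: _).
- rewrite -[in RHS]euler_vdm scaler_sumr mulr_suml exchange_big.
  apply: eq_bigr => j _; rewrite -euler_theta_vdm mulr_suml.
  by apply: eq_bigr => i _; rewrite mulr_sumr.
- rewrite (sum_split3 (fun i j => W i i j) (fun i j => W i j i) (fun i j => W i j j)).
  rewrite -addrA; congr (_ + _).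
    by rewrite -p2E mulr_suml; apply: eq_bigr => i _; rewrite mulr_sumr.
  rewrite mulr_natl mulr2n scaler_sumr; congr (_ + _).
    apply: eq_bigr => i _; rewrite scalerAl -euler_theta_vdm mulr_suml.
    by apply: eq_bigr => j _; rewrite /W theta_comm.
  rewrite exchange_big; apply: eq_bigr => i _.
  by rewrite scalerAl -euler_theta_vdm mulr_suml.
Qed.

Lemma subset_sum30 :
  \sum_(I : {set 'I_n} | #|I| == r) thetas I (thetas I (thetas I Del)) =
  S3 *: (d *: (d *: (d *: Del))) + S21 *: (3 * (d *: (p2 *: Del)))
  + S111 *: (p3 *: Del).
Proof.
rewrite subset_sum3.
have eulerZ (c : K) p : euler (c *: p) = c *: euler p.
  by rewrite scaler_sumr; apply: eq_bigr => i _; rewrite thetaZ.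
rewrite euler_vdm !eulerZ euler_vdm !eulerZ euler_vdm.
congr (_ + _ *: (3 * _) + _ *: _).
  under eq_bigr do rewrite !thetaZ.
  by rewrite -scaler_sumr (sum_iter_theta_vdm K n 2).
exact: (sum_iter_theta_vdm K n 3).
Qed.

Lemma macdonald_order3_vdm f :
  Del%:F * macdonald_order beta r 3 f =
  ((1 / 6) *: (\sum_(I : {set 'I_n} | #|I| == r)
                 Del * thetas I (thetas I (thetas I f)))
  + (beta / 2) *: (\sum_(I : {set 'I_n} | #|I| == r)
                 thetas I Del * thetas I (thetas I f))
  + (beta ^+ 2 / 2) *: (\sum_(I : {set 'I_n} | #|I| == r)
                 thetas I (thetas I Del) * thetas I f)
  + (beta ^+ 3 / 6) *: (\sum_(I : {set 'I_n} | #|I| == r)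
                 thetas I (thetas I (thetas I Del)) * f))%:F.
Proof.
rewrite macdonald_order_vdm //; congr tofrac.
rewrite !scaler_sumr -!big_split; apply: eq_bigr => I _.
by rewrite !big_ord_recr big_ord0 /= add0r expr0 expr1.
Qed.

Local Notation b := (beta%:MP%:F : L).
Local Notation u := (ukern (fun i : 'I_n => ('X_i : MP)%:F)).

Lemma tofrac_sum_theta_vdm (q : 'I_n -> MP) :
  (\sum_i theta i Del * q i)%:F = Del%:F * \sum_i ksum u i * (q i)%:F.
Proof.
rewrite tofrac_sum mulr_sumr; apply: eq_bigr => i _.
by rewrite tofracM theta_vdm mulrA [Del%:F * _]mulrC.
Qed.

Lemma tofrac_sum_theta2_vdm (q : 'I_n -> MP) :
  (\sum_i theta i (theta i Del) * q i)%:F = Del%:F * \sum_i ksum2 u i * (q i)%:F.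
Proof.
rewrite tofrac_sum mulr_sumr; apply: eq_bigr => i _.
by rewrite tofracM theta2_vdm mulrA [Del%:F * _]mulrC.
Qed.

Lemma dunklH2_vdm f : f \is symmetric ->
  Del%:F * (dunklH beta 2 f)%:F = Del%:F * (\sum_i theta i (theta i f))%:F
  + b * (2 * (\sum_i theta i Del * theta i f)%:F
         - ((n%:R : K)%:MP%:F - 1) * (Del%:F * (euler f)%:F)).
Proof.
move=> f_sym; rewrite tofrac_sum_theta_vdm -natr_frac.
by apply: clear_dunkl2; rewrite (tofrac_dunklH2 beta f_sym) !tofrac_sum.
Qed.

Lemma dunklH3_vdm f : f \is symmetric ->
  2 * (Del%:F * (dunklH beta 3 f)%:F) =
  2 * (Del%:F * (\sum_i theta i (theta i (theta i f)))%:F)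
  + 6 * b * (\sum_i theta i Del * theta i (theta i f))%:F
  + 6 * b ^+ 2 * (\sum_i theta i (theta i Del) * theta i f)%:F
  - b * (Del%:F * (euler (euler f))%:F)
  - b * (2 * (n%:R : K)%:MP%:F - 3) * (Del%:F * (\sum_i theta i (theta i f))%:F
       + 2 * b * (\sum_i theta i Del * theta i f)%:F)
  - 2 * b ^+ 2 * ((n%:R : K)%:MP%:F - 1) * (Del%:F * (euler f)%:F).
Proof.
move=> f_sym; rewrite !tofrac_sum_theta_vdm tofrac_sum_theta2_vdm -natr_frac.
have -> : (euler (euler f))%:F = \sum_i \sum_j (theta i (theta j f))%:F.
  by rewrite -sum_theta2 tofrac_sum; apply: eq_bigr => i _; rewrite tofrac_sum.
by apply: clear_dunkl3; rewrite (tofrac_dunklH3 beta f_sym) !tofrac_sum.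
Qed.

End ThirdOrder.

Lemma third_order_mpoly (K : fieldType) (n : nat) (N r kap beta d p2 p3 : K)
    (D H3 H2 H2E E3 E2 E1 f V1 V1E V2 V3 T2 T2E T3 : {mpoly K[n]}) :
  2 != 0 :> K -> 3 != 0 :> K -> N - 2 != 0 -> r != 0 -> D != 0 ->
  d = N * (N - 1) / 2 -> p2 = N * (N - 1) * (2 * N - 1) / 6 ->
  p3 = N ^+ 2 * (N - 1) ^+ 2 / 4 ->
  let b := beta%:MP%:F in let N' := N%:MP%:F in
  D%:F * H2%:F = D%:F * T2%:F + b * (2 * V1%:F - (N' - 1) * (D%:F * E1%:F)) ->
  D%:F * H2E%:F = D%:F * T2E%:F + b * (2 * V1E%:F - (N' - 1) * (D%:F * E2%:F)) ->
  2 * (D%:F * H3%:F) = 2 * (D%:F * T3%:F) + 6 * b * V2%:F + 6 * b ^+ 2 * V3%:F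
    - b * (D%:F * E2%:F)
    - b * (2 * N' - 3) * (D%:F * T2%:F + 2 * b * V1%:F)
    - 2 * b ^+ 2 * (N' - 1) * (D%:F * E1%:F) ->
  let S3 := kap * (r - 1) * (r - 2) in
  let S21 := kap * (N - r) * (r - 1) in
  let S111 := kap * (N - r) * (N - 2 * r) in
  ((1 / 6) *: (D * (S3 *: E3 + S21 *: (3 * T2E) + S111 *: T3))
  + (beta / 2) *: (S3 *: (d *: D * E2)
       + S21 *: (2 * V1E + d *: D * T2) + S111 *: V2)
  + (beta ^+ 2 / 2) *: (S3 *: (d *: (d *: D) * E1)
       + S21 *: (p2 *: D * E1 + 2 * (d *: V1)) + S111 *: V3)
  + (beta ^+ 3 / 6) *: ((S3 *: (d *: (d *: (d *: D)))
       + S21 *: (3 * (d *: (p2 *: D))) + S111 *: (p3 *: D)) * f))%:F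
  = D%:F * ((1 / 6 * (kap * (N - r) * (N - 2 * r))) *: H3
    + (1 / 2 * (kap * (N - r) * (r - 1))) *: H2E
    + ((N ^+ 2 * (3 * r - 1) - 7 * r * N + 6 * r) / (12 * (N - 2))
          * (kap * (N - 2) * (N - r)) * beta) *: H2
    + (1 / 6 * (kap * (r - 1) * (r - 2))) *: E3
    + (beta / 12 * kap * ((3 * r ^+ 2 - 3 * r + 1) * N ^+ 2
            + (- 9 * r ^+ 2 + 6 * r) * N + 8 * r ^+ 2 - 6 * r)) *: E2
    + (beta ^+ 2 * r / 24 * ((3 * r + 1) * N ^+ 2 + (1 - 7 * r) * N + 2 * r)
         * (kap * (N - 1) * (N - 2))) *: E1
    + (beta ^+ 3 * (kap * N * (N - 1) * (N - 2) / r)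
         * (r ^+ 2 * N * (N - 1) / 48) * ((r + 1) * N + 1 - 3 * r)) *: f)%:F.
Proof.
move=> two3 three N2 r0 D0 ed ep2 ep3 b N' e2 e2E e3 S3 S21 S111.
pose io : {rmorphism K -> {fraction {mpoly K[n]}}} :=
  @tofrac {mpoly K[n]} \o @mpolyC n K.
have D0' : D%:F != 0 by rewrite tofrac_eq0.
have E := @third_order_identity K _ io N r kap beta d p2 p3 D%:F H3%:F H2%:F
  H2E%:F E3%:F E2%:F E1%:F f%:F V1%:F V1E%:F V2%:F V3%:F T2%:F T2E%:F T3%:F
  two3 three N2 r0 D0' ed ep2 ep3 e2 e2E e3.
have t2 : 2%:F = 2 :> {fraction {mpoly K[n]}} by exact: rmorph_nat.
have t3 : 3%:F = 3 :> {fraction {mpoly K[n]}} by exact: rmorph_nat.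
have tZ (c : K) (p : {mpoly K[n]}) : (c *: p)%:F = io c * p%:F by exact: tofracZ.
rewrite !(t2, t3, tofracD, tZ, tofracM).
exact: E.
Qed.

Theorem theorem6p1 (K : fieldType) (charK : [pchar K] =i pred0) (beta : K)
    (n r : nat) (n_ge3 : (3 <= n)%N) (r_bounds : (1 <= r <= n)%N)
    (f : {mpoly K[n]}) (f_sym : f \is symmetric) :
  let H := @dunklH K n beta in
  let N : K := n%:R in
  let r' : K := r%:R in
  let bin (a : nat) (b : int) : K := (binomz a b)%:R in
  macdonald_order beta r 3 f =
  ( (1 / 6 * coefH3 K n r) *: H 3%N f
    + (1 / 2 * bin (n - 3)%N (r%:Z - 2)) *: H 2%N (H 1%N f)
    + ((N ^+ 2 * (3 * r' - 1) - 7 * r' * N + 6 * r') / (12 * (N - 2))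
         * bin (n - 2)%N (r%:Z - 1) * beta) *: H 2%N f
    + (1 / 6 * bin (n - 3)%N (r%:Z - 3)) *: H 1%N (H 1%N (H 1%N f))
    + (beta / 12 * coefH11 K n r
         * ((3 * r' ^+ 2 - 3 * r' + 1) * N ^+ 2
            + (- 9 * r' ^+ 2 + 6 * r') * N + 8 * r' ^+ 2 - 6 * r'))
        *: H 1%N (H 1%N f)
    + (beta ^+ 2 * r' / 24
         * ((3 * r' + 1) * N ^+ 2 + (1 - 7 * r') * N + 2 * r')
         * bin (n - 1)%N (r%:Z - 1)) *: H 1%N f
    + (beta ^+ 3 * bin n r%:Z * (r' ^+ 2 * N * (N - 1) / 48)
         * ((r' + 1) * N + 1 - 3 * r')) *: f )%:F.
Proof.
have [r_gt0 le_rn] := andP r_bounds.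
move=> H N r' bin.
pose D := (vdmX K n)%:F; pose kap := coefH11 K n r.
have D0 : D != 0 by rewrite tofrac_eq0 vdmX_neq0.
(* H_1 is the Euler operator on symmetric polynomials only, so its iterates need the symmetry of H_1
   f and H_1^2 f. *)
have E1_sym := sum_theta_sym f_sym; have E2_sym := sum_theta_sym E1_sym.
rewrite /H (dunklH1 beta f_sym) (dunklH1 beta E1_sym) (dunklH1 beta E2_sym).
rewrite /bin (coefH3_kap charK n_ge3 r_bounds) (binomz_kap3l charK n_ge3 r_bounds).
rewrite (binomz_kap2 charK n_ge3 r_bounds) (binomz_kap3r charK n_ge3 r_bounds).
rewrite (binomz_kap1 charK n_ge3 r_bounds).
rewrite -[binomz n r%:Z]/('C(n, r)) (bin_kap0 charK n_ge3 r_bounds).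
rewrite -/N -/r' -/kap.
apply: (mulfI D0); rewrite /D macdonald_order3_vdm //.
rewrite -mulr_sumr -mulr_suml subset_sum3 // subset_sum12 // subset_sum21 //.
rewrite subset_sum30 //.
have S3E : 'C(n - 3, n - r)%:R = kap * (r' - 1) * (r' - 2) :> K.
  exact: bin_kap3r.
have S21E : 'C(n - 2, n - r)%:R - 'C(n - 3, n - r)%:R
    = kap * (N - r') * (r' - 1) :> K.
  by rewrite bin_kap2r // bin_kap3r // -/kap -/N -/r'; ring.
have S111E : 'C(n - 1, n - r)%:R - 3 * 'C(n - 2, n - r)%:R
     + 2 * 'C(n - 3, n - r)%:R = kap * (N - r') * (N - 2 * r') :> K.
  have -> : 'C(n - 1, n - r) = 'C(n - 1, r - 1).
    by rewrite -bin_sub; [congr 'C(_, _)|]; lia.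
  rewrite bin_kap1 // bin_kap2r // bin_kap3r // -/kap -/N -/r'; ring.
rewrite S111E S21E S3E.
have natK m : (0 < m)%N -> m%:R != 0 :> K by apply: natf_neq0_pchar0.
apply: third_order_mpoly.
- exact: natK.
- exact: natK.
- by rewrite /N -[_ - _](natrB K (m := n) (n := 2)) ?natK; lia.
- exact: natK.
- exact: vdmX_neq0.
- exact: power_sum1.
- exact: power_sum2.
- exact: power_sum3.
- exact: (dunklH2_vdm beta f_sym).
- exact: (dunklH2_vdm beta E1_sym).
- exact: (dunklH3_vdm beta f_sym).
Qed.
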